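(* Let $\alpha\in(0,1)$, $b\ge0$, $c>0$, $\lambda\ge0$ and $g\in L^\infty(\mathbb R_+;\mathbb R_+)$. The nonlinear Volterra integral equation $$v(x)=\lambda W'(x)+\big(g-\mathcal V_\alpha\circ v\big)*W'(x),\quad x>0,$$ is equivalent to the fractional differential equation $$D^\alpha_cv=g-b\,v-\mathcal V_\alpha\circ v\quad\text{with}\quad (L_K*v)(0)=\lambda.$$
   Context: $\Phi(\lambda)=b\lambda+c\lambda^{\alpha+1}$; $\nu_\alpha(dy)=\frac{c\alpha(\alpha+1)}{\Gamma(1-\alpha)}y^{-\alpha-2}dy$ on $(0,\infty)$. $W$ is the scale function: zero on $(-\infty,0)$, continuous, strictly increasing on $[0,\infty)$, $\int_0^\infty e^{-\lambda x}W(x)dx=1/\Phi(\lambda)$ for $\lambda>0$; $W'$ is its derivative on $(0,\infty)$. Convolution: $f*h(x)=\int_0^xf(x-s)h(s)ds$; $x^+=\max(x,0)$. $L_K(x)=\frac{c\,x^{-\alpha}}{\Gamma(1-\alpha)}$, $x>0$, and $D^\alpha_cf(x)=\frac{d}{dx}(L_K*f)(x)=\frac{d}{dx}\int_0^x\frac{c(x-s)^{-\alpha}}{\Gamma(1-\alpha)}f(s)ds$ is the Riemann–Liouville derivative of order $\alpha$ modified by $c$. The initial value $(L_K*v)(0)$ is the limit of $(L_K*v)(x)$ as $x\to0+$. The differential equation is understood in the sense that $L_K*v$ is locally absolutely continuous and the identity holds for almost every $x>0$. The operator $\mathcal V_\alpha$ acts on a locally integrable $f$ by $$\mathcal V_\alpha\circ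 f(x)=\int_0^\infty\Big(\exp\Big\{-\int_{(x-y)^+}^xf(r)dr\Big\}-1+\int_{(x-y)^+}^xf(r)dr\Big)\nu_\alpha(dy).$$ Solutions $v$ are continuous functions on $(0,\infty)$ with $\sup_{x\in(0,T]}x^{1-\alpha}|v(x)|<\infty$ for any $T>0$; ''equivalent'' means that the two problems have the same solutions. *)

(* Defs.v *)
From HB Require Import structures.
From mathcomp Require Import all_boot all_order all_algebra.
From mathcomp Require Import all_classical all_reals all_analysis.

Set Implicit Arguments.
Unset Strict Implicit.
Unset Printing Implicit Defensive.

Import Order.TTheory GRing.Theory Num.Theory.
Import numFieldNormedType.Exports.

Local Open Scope classical_set_scope.
Local Open Scope ring_scope.

(* [Rintegral] is total, with value 0 when the extended integral is not finite.
   For a function in [solution_class] every integral occurring in the two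
   problems below converges absolutely, so this convention plays no role. *)

Section volterra_fractional.
Context {R : realType}.
Implicit Types (alpha b c lambda x y : R) (f h g v W : R -> R).

Local Notation mu := (@lebesgue_measure R).

(* Euler's Gamma function; meaningful for [0 < z]. *)
Definition Gamma (z : R) : R :=
  \int[mu]_(t in `]0, +oo[) (t `^ (z - 1) * expR (- t)).

Definition Phi alpha b c (l : R) : R := b * l + c * l `^ (alpha + 1).

(* The density of [nu_alpha] on (0, +oo). *)
Definition nu_density alpha c y : R :=
  c * alpha * (alpha + 1) / Gamma (1 - alpha) * y `^ (- alpha - 2).

(* The Laplace identity is between extended reals; as its right-hand side is
   finite, it includes the integrability of the left-hand side. *)
Definition is_scale_function alpha b c W : Prop :=
  [/\ forall x, x < 0 -> W x = 0,
      {within `[0, +oo[, continuous W},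
      {in `[0, +oo[ &, {homo W : x y / x < y}} &
      forall l, 0 < l ->
        (\int[mu]_(x in `[0%R, +oo[) (expR (- l * x) * W x)%:E
         = ((Phi alpha b c l)^-1)%:E)%E].

Definition convol f h : R -> R :=
  fun x => \int[mu]_(s in `]0, x[) (f (x - s) * h s).

Definition L_K alpha c x : R := c * x `^ (- alpha) / Gamma (1 - alpha).

Definition RL_deriv alpha c f : R -> R := derive1 (convol (L_K alpha c) f).

Definition V_op alpha c f : R -> R := fun x =>
  \int[mu]_(y in `]0, +oo[)
     ((expR (- \int[mu]_(r in `]Num.max (x - y) 0, x[) f r) - 1
       + \int[mu]_(r in `]Num.max (x - y) 0, x[) f r) * nu_density alpha c y).

(* [L^oo(R_+; R_+)]: the extension of [g] by zero outside [0, +oo) is in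
   [L^oo], and [g] is nonnegative almost everywhere on [0, +oo). *)
Definition Linfty_nonneg g : Prop :=
  (g \_ `[0, +oo[ \in Lfun mu +oo%E) /\
  (\forall x \ae mu, 0 <= x -> 0 <= g x).

Definition abs_continuous (p q : R) f : Prop :=
  forall e : R, 0 < e -> exists2 d : R, 0 < d &
    forall (n : nat) (u w : 'I_n -> R),
      (forall i, u i <= w i /\ `]u i, w i[ `<=` `[p, q]) ->
      trivIset setT (fun i => `]u i, w i[%classic) ->
      \sum_(i < n) (w i - u i) < d ->
      \sum_(i < n) `|f (w i) - f (u i)| < e.

Definition locally_abs_continuous f : Prop :=
  forall p q : R, 0 < p -> p < q -> abs_continuous p q f.

(* Only the values on (0, +oo) matter, both here and in the two problems. *)
Definition solution_class alpha v : Prop :=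
  {in `]0, +oo[, continuous v} /\
  forall T : R, 0 < T ->
    has_ubound [set x `^ (1 - alpha) * `|v x| | x in `]0, T]].

Definition volterra_solution alpha c lambda g W v : Prop :=
  solution_class alpha v /\
  forall x, 0 < x ->
    v x = lambda * derive1 W x
          + convol (fun s => g s - V_op alpha c v s) (derive1 W) x.

(* [derive1] is total, so the existence of the derivative is required
   explicitly in the almost everywhere identity. *)
Definition fractional_solution alpha b c lambda g v : Prop :=
  [/\ solution_class alpha v,
      locally_abs_continuous (convol (L_K alpha c) v),
      (\forall x \ae mu, 0 < x ->
         derivable (convol (L_K alpha c) v) x 1 /\
         RL_deriv alpha c v x = g x - b * v x - V_op alpha c v x) &
      convol (L_K alpha c) v x @[x --> 0^'+] --> lambda].

End volterra_fractional.

(* Main.v *)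
(* Let k(x) = x^(alpha-1) / (c Gamma(alpha)), so that L_K * k = 1. Picard iteration
   in a weighted sup norm gives w with w = k - b (k * w), whose Laplace transform
   is 1 / (b + c l^alpha); injectivity of the Laplace transform then yields
   W = 1 * w on (0, oo), so W' = w and L_K * w = 1 - b W.

   Put F = g - V v. Convolving the Volterra equation v = lambda w + w * F with
   L_K gives L_K * v = lambda + 1 * (F - b v), which is the integrated form of the
   fractional equation because an absolutely continuous function is recovered
   from its derivative. Conversely, convolving the latter identity with w gives
   1 * v = 1 * (lambda w + w * F), and both integrands are continuous. Everything
   is O(x^(q-1)) at 0 for some q > 0, including V v, so that all these
   convolutions converge absolutely. *)
Require Import Defs.
From HB Require Import structures.
From mathcomp Require Import all_boot all_order all_algebra.
From mathcomp Require Import all_classical all_reals all_analysis.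
From mathcomp Require Import measurable_realfun ess_sup_inf.
From mathcomp Require Import lra ring.

Set Implicit Arguments.
Unset Strict Implicit.
Unset Printing Implicit Defensive.

Import Order.TTheory GRing.Theory Num.Theory.
Import numFieldNormedType.Exports.

Local Open Scope classical_set_scope.
Local Open Scope ring_scope.

(** * Affine substitutions *)

(** The conditions on W contain no differentiability, and the Laplace transform of w is computed
    only for large l; injectivity is therefore proved from an arbitrary abscissa on, by testing
    against polynomials in exp(- x). The weight x^(alpha - 1) exp(l x) serves twice: for large l it
    makes the Picard map a contraction on all of (0, oo) at once, and the bound it leaves on w gives
    Laplace integrability.

    The two kernels have different singularities, x^(- alpha) and x^(alpha - 1), so the algebra of
    convolutions is carried out in one class, with exponent min(alpha, 1 - alpha). Beta integrals
    are bounded but never evaluated.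

    Two points need more than algebra. Since F is merely measurable and w may be unbounded at 0, the
    continuity of w * F is obtained by damping w near 0. And a derivative vanishing almost
    everywhere does not force a function to be constant; with absolute continuity it does, which is
    shown by real induction along an open cover of the exceptional set. *)

Section affine_substitution.
Context {R : realType}.
Local Notation mu := (@lebesgue_measure R).
Local Open Scope ereal_scope.

Section affine.
Variables a b : R.
Hypothesis a0 : a != 0%R.
Let phi : measurableTypeR R -> measurableTypeR R := fun x => (a * x + b)%R.

Lemma measurable_affine : measurable_fun setT (fun x : R => (a * x + b)%R).
Proof. by apply: measurable_funD => //; exact: measurable_funM. Qed.

Let mphi : measurable_fun setT phi.
Proof. exact: measurable_affine. Qed.

Let k : {nonneg R} := NngNum (normr_ge0 a).

Let m := mscale k
  (@measure_function_pushforward__canonical__measure_function_Measure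
     _ _ _ _ _ mu phi mphi).

(** Lebesgue measure is determined by its values on half-open intervals. For negative [a] the
    preimage of such an interval is closed on the other side, which leaves its measure the same. *)
Let lebesgue_affine A : measurable A -> mu A = m A.
Proof.
apply: lebesgue_measure_unique => X [[u v]] /= _ <-.
rewrite /m /= /mscale /= /pushforward lebesgue_measure_itv/= lte_fin.
have [uv|vu] := ltP u v; last first.
  rewrite set_itv_ge ?preimage_set0 ?measure0 ?mule0//.
  by rewrite bnd_simp -leNgt.
have [agt0|alt0] := ltrP 0%R a.
  have -> : phi @^-1` `]u, v] = `]((u - b) / a)%R, ((v - b) / a)%R]%classic.
    apply/seteqP; split => x; rewrite /phi /= !in_itv /= ltr_pdivrMr// ler_pdivlMr//;
      by rewrite ltrBlDr lerBrDr mulrC.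
  rewrite lebesgue_measure_itv/= lte_fin ltr_pM2r ?invr_gt0// ltrD2r uv.
  rewrite gtr0_norm// -!EFinB -EFinM; congr EFin.
  by field.
have {}alt0 : (a < 0)%R by rewrite lt_neqAle a0 alt0.
have -> : phi @^-1` `]u, v] = `[((v - b) / a)%R, ((u - b) / a)%R[%classic.
  apply/seteqP; split => x; rewrite /phi /= !in_itv /= ltr_ndivlMr// ler_ndivrMr//;
    by rewrite ltrBlDr lerBrDr [(x * a)%R]mulrC andbC.
rewrite lebesgue_measure_itv/= lte_fin ltr_nM2r ?invr_lt0// ltrD2r uv.
rewrite ltr0_norm// -!EFinB -EFinM; congr EFin.
by field.
Qed.

Lemma ge0_integral_affine (f : R -> \bar R) :
  measurable_fun setT f -> (forall x, 0 <= f x) ->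
  \int[mu]_x f x = `|a|%:E * \int[mu]_x f (a * x + b)%R.
Proof.
move=> mf f0; rewrite (@eq_measure_integral _ _ _ _ m); last first.
  by move=> A mA _; exact: lebesgue_affine.
rewrite ge0_integral_mscale//.
by rewrite (ge0_integral_pushforward mphi).
Qed.

End affine.

Lemma measurable_refl (b : R) : measurable_fun setT (fun x : R => (b - x)%R).
Proof. exact: measurable_funB. Qed.

Lemma ge0_integral_refl (b : R) (f : R -> \bar R) :
  measurable_fun setT f -> (forall x, 0 <= f x) ->
  \int[mu]_x f (b - x)%R = \int[mu]_x f x.
Proof.
move=> mf f0; rewrite (@ge0_integral_affine (-1)%R b _ f)//.
by rewrite normrN1 mul1e; apply: eq_integral => x _; congr f; ring.
Qed.

Lemma integral_refl (b : R) (f : R -> \bar R) : measurable_fun setT f ->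
  \int[mu]_x f (b - x)%R = \int[mu]_x f x.
Proof.
move=> mf; rewrite integralE [in RHS]integralE.
have mp := measurable_funepos mf; have mn := measurable_funeneg mf.
rewrite -(ge0_integral_refl b mp)// -(ge0_integral_refl b mn)//.
by congr (_ - _); apply: eq_integral => x _; rewrite ?funeposE ?funenegE.
Qed.

Lemma ge0_integral_shift (b : R) (f : R -> \bar R) :
  measurable_fun setT f -> (forall x, 0 <= f x) ->
  \int[mu]_x f (x - b)%R = \int[mu]_x f x.
Proof.
move=> mf f0; rewrite (@ge0_integral_affine 1%R (- b) _ f)//.
by rewrite normr1 mul1e; apply: eq_integral => x _; rewrite mul1r.
Qed.

Lemma integral_shift (b : R) (f : R -> \bar R) : measurable_fun setT f ->
  \int[mu]_x f (x - b)%R = \int[mu]_x f x.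
Proof.
move=> mf; rewrite integralE [in RHS]integralE.
have mp := measurable_funepos mf; have mn := measurable_funeneg mf.
rewrite -(ge0_integral_shift b mp)// -(ge0_integral_shift b mn)//.
by congr (_ - _); apply: eq_integral => x _; rewrite ?funeposE ?funenegE.
Qed.

Lemma ge0_integral_scale (a : R) (f : R -> \bar R) : (0 < a)%R ->
  measurable_fun setT f -> (forall x, 0 <= f x) ->
  \int[mu]_x f x = a%:E * \int[mu]_x f (a * x)%R.
Proof.
move=> a0 mf f0; rewrite (@ge0_integral_affine a 0%R _ f)//.
  by rewrite gtr0_norm//; congr (_ * _); apply: eq_integral => x _; rewrite addr0.
by rewrite gt_eqF.
Qed.

End affine_substitution.

(** * Singular functions and their convolutions *)

Section power_integrals.
Context {R : realType}.
Local Notation mu := (@lebesgue_measure R).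

Lemma le_powR_neg (q u v : R) : q <= 1 -> 0 < u -> u <= v -> v `^ (q - 1) <= u `^ (q - 1).
Proof.
move=> q1 u0 uv; rewrite -opprB !powRN lef_pV2 ?posrE ?powR_gt0//; last exact: lt_le_trans uv.
by apply: ge0_ler_powR; rewrite ?nnegrE ?subr_ge0// ltW// (lt_le_trans u0).
Qed.

Lemma integral_powR_itvcc (q a b : R) : q != 0 -> 0 < a -> a < b ->
  (\int[mu]_(x in `[a, b]) (x `^ (q - 1))%:E = ((b `^ q - a `^ q) / q)%:E)%E.
Proof.
move=> q0 a0 ab.
have pos x : a < x -> 0 < x by exact: lt_trans.
have cpow p x : 0 < x -> {for x, continuous (fun y : R => y `^ p)}.
  move=> x0; apply: differentiable_continuous; apply/derivable1_diffP.
  by apply: derivable_powR; rewrite in_itv/= x0.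
have := @continuous_FTC2 R (fun x => x `^ (q - 1)) (fun x => q^-1 * x `^ q) a b ab.
rewrite -EFinB -mulrBr mulrC; apply.
- apply/continuous_within_itvP => //; split.
  + by move=> x; rewrite in_itv/= => /andP[/pos x0 _]; exact: cpow.
  + by apply: cvg_at_right_filter; exact: cpow.
  + by apply: cvg_at_left_filter; apply: cpow; exact: pos.
- split.
  + move=> x; rewrite in_itv/= => /andP[/pos x0 _].
    by apply: derivableM => //; apply: derivable_powR; rewrite in_itv/= x0.
  + by apply: cvg_at_right_filter; apply: cvgMr; exact: cpow.
  + by apply: cvg_at_left_filter; apply: cvgMr; apply: cpow; exact: pos.
- move=> x; rewrite in_itv/= => /andP[/pos x0 _].
  rewrite derive1E deriveMl//=; last by apply: derivable_powR; rewrite in_itv/= x0.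
  by rewrite -derive1E powR_derive1 ?in_itv/= ?x0// /GRing.scale/= mulrA mulVf// mul1r.
Qed.

(** Monotone convergence, in the form that carries bounds from compact intervals inside (0, oo),
    where the fundamental theorem of calculus applies, to intervals reaching 0 or infinity. *)
Lemma ge0_integral_bigcup_le (F : (set R)^nat) (f : R -> \bar R) (M : \bar R) :
  nondecreasing_seq F -> (forall n, measurable (F n)) ->
  measurable_fun (\bigcup_n F n) f ->
  (forall x, (\bigcup_n F n) x -> (0 <= f x)%E) ->
  (forall n, (\int[mu]_(x in F n) f x <= M)%E) ->
  (\int[mu]_(x in \bigcup_n F n) f x <= M)%E.
Proof.
move=> ndF mF mf f0 fM.
have mfn n : measurable_fun (F n) f.
  by apply: measurable_funS mf => //; [exact: bigcup_measurable|exact: bigcup_sup].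
have f0n n x : F n x -> (0 <= f x)%E by move=> Fx; apply: f0; exists n.
have h : (\int[mu]_(x in F i) f x)%E @[i --> \oo] -->
    (\int[mu]_(x in \bigcup_i F i) f x)%E.
  exact: ge0_nondecreasing_set_cvg_integral.
rewrite -(cvg_lim _ h)//; apply: lime_le; last exact: nearW.
by apply/cvg_ex; eexists; exact: h.
Qed.

Lemma measurable_powR_itv (p : R) (D : set R) :
  measurable_fun D (fun x : R => (x `^ p)%:E).
Proof. by apply/measurable_EFinP/measurable_funTS; exact: measurable_powR. Qed.

Lemma integral_powR_itvoo_le (q b : R) : 0 < q -> 0 < b ->
  (\int[mu]_(x in `]0%R, b[) (x `^ (q - 1))%:E <= (b `^ q / q)%:E)%E.
Proof.
move=> q0 b0.
(* The shift [n.+2] keeps the left endpoint strictly below [b], as [integral_powR_itvcc]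
   requires. *)
have bE : `]0, b]%classic = \bigcup_n `[(b / n.+2%:R), b]%classic.
  apply/seteqP; split => x /=; rewrite in_itv/=.
    move=> /andP[x0 xb]; have /= := archi_boundP (ltW (divr_gt0 b0 x0)).
    set N := Num.bound _ => h; exists N => //=; rewrite in_itv/= xb andbT.
    rewrite ler_pdivrMr// mulrC -ler_pdivrMr// (le_trans (ltW h))// ler_nat.
    by rewrite leqW.
  move=> [n _]/=; rewrite in_itv/= => /andP[nx ->]; rewrite andbT.
  by apply: lt_le_trans nx; rewrite divr_gt0.
apply: (@le_trans _ _ (\int[mu]_(x in `]0%R, b]) (x `^ (q - 1))%:E)%E).
  apply: ge0_subset_integral => //; first exact: measurable_powR_itv.
    by move=> x _; rewrite lee_fin powR_ge0.
  by apply: subset_itvl; rewrite bnd_simp.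
rewrite bE; apply: ge0_integral_bigcup_le => //.
- move=> m n mn; apply/subsetPset; apply: subset_itvr; rewrite bnd_simp.
  by rewrite ler_pM2l// lef_pV2 ?posrE// ler_nat !ltnS.
- exact: measurable_powR_itv.
- by move=> x _; rewrite lee_fin powR_ge0.
move=> n; rewrite integral_powR_itvcc ?gt_eqF// ?divr_gt0//; last first.
  by rewrite ltr_pdivrMr// ltr_pMr// ltr1n.
by rewrite lee_fin ler_pM2r ?invr_gt0// gerBl powR_ge0.
Qed.

Lemma integral_powR_itvcy_le (q a : R) : 0 < q -> 0 < a ->
  (\int[mu]_(x in `[a, +oo[) (x `^ (- q - 1))%:E <= (a `^ (- q) / q)%:E)%E.
Proof.
move=> q0 a0.
have aE : `[a, +oo[%classic = \bigcup_n `[a, (a + n.+1%:R)]%classic.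
  apply/seteqP; split => x /=; rewrite in_itv/= ?andbT.
    move=> ax; have /= := archi_boundP (normr_ge0 x).
    set N := Num.bound _ => h; exists N => //=; rewrite in_itv/= ax/=.
    rewrite (le_trans (ler_norm x))// (le_trans (ltW h))// (@le_trans _ _ N.+1%:R)//.
      by rewrite ler_nat.
    by rewrite lerDr ltW.
  by move=> [n _]/=; rewrite in_itv/= => /andP[].
rewrite aE; apply: ge0_integral_bigcup_le => //.
- move=> m n mn; apply/subsetPset; apply: subset_itvl; rewrite bnd_simp.
  by rewrite lerD2l ler_nat ltnS.
- exact: measurable_powR_itv.
- by move=> x _; rewrite lee_fin powR_ge0.
move=> n; rewrite integral_powR_itvcc ?oppr_eq0 ?gt_eqF// ?ltrDl//.
rewrite lee_fin invrN mulrN -mulNr ler_pM2r ?invr_gt0// opprB gerBl.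
exact: powR_ge0.
Qed.

End power_integrals.

Section singular_class.
Context {R : realType}.
Local Notation mu := (@lebesgue_measure R).
Local Notation pos := (`]0, +oo[%classic : set R).

(* For [0 < q <= 1], convolutions of such functions converge absolutely at every
   point and belong to the class again. *)
Definition singular (q : R) (f : R -> R) : Prop :=
  measurable_fun pos f /\
  forall T : R, 0 < T -> exists2 C : R, 0 <= C &
    forall x, 0 < x -> x <= T -> `|f x| <= C * x `^ (q - 1).

Lemma subitv_pos (x : R) : `]0, x[ `<=` pos.
Proof. exact: subset_itvl. Qed.

Lemma measurable_pos_itv (x : R) f :
  measurable_fun pos f -> measurable_fun (`]0, x[ : set R) (f : R -> R).
Proof. by apply: measurable_funS => //; exact: subitv_pos. Qed.

Lemma measurable_pos_refl (x : R) f :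
  measurable_fun pos f ->
  measurable_fun (`]0, x[ : set R) (fun s => (f : R -> R) (x - s)).
Proof.
move=> mf; apply: (@measurable_comp _ _ _ _ _ _ pos) => //.
  by move=> _ [s /=] /[!in_itv]/= /andP[s0 sx] <-; rewrite subr_gt0 sx.
by apply: measurable_funTS; exact: measurable_refl.
Qed.

Lemma integral_itv_refl (x : R) (f : R -> \bar R) :
  measurable_fun `]0, x[ f ->
  (\int[mu]_(s in `]0%R, x[) f (x - s)%R = \int[mu]_(s in `]0%R, x[) f s)%E.
Proof.
move=> mf; rewrite integral_mkcond [RHS]integral_mkcond.
rewrite -[RHS](integral_refl x); last exact/(measurable_restrictT _ _).1.
apply: eq_integral => s _; rewrite !patchE.
have -> // : (s \in (`]0, x[%classic : set R)) = (x - s \in (`]0, x[%classic : set R)).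
by apply/idP/idP; rewrite !inE/= !in_itv/= => /andP[? ?]; apply/andP; split; lra.
Qed.

Lemma convolC f h (x : R) :
  measurable_fun pos f -> measurable_fun pos h ->
  convol f h x = convol h f x.
Proof.
move=> mf mh; rewrite /convol/Rintegral; congr fine.
have mF : measurable_fun `]0, x[ (fun s => (f (x - s) * h s)%:E).
  apply/measurable_EFinP; apply: measurable_funM; last exact: measurable_pos_itv.
  exact: measurable_pos_refl.
rewrite -(integral_itv_refl mF); apply: eq_integral => s _.
by rewrite subKr mulrC.
Qed.

Lemma integrable_powR_itv (q b : R) : 0 < q ->
  mu.-integrable `]0, b[ (fun x => (x `^ (q - 1))%:E).
Proof.
move=> q0; apply/integrableP; split; first exact: measurable_powR_itv.
under eq_integral do rewrite /= ger0_norm ?powR_ge0//.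
have [b0|b0] := ltP 0 b.
  exact: le_lt_trans (integral_powR_itvoo_le q0 b0) (ltry _).
by rewrite set_itv_ge ?integral_set0 ?ltry// bnd_simp -leNgt.
Qed.

Lemma integrable_itv_refl (x : R) (f : R -> \bar R) :
  mu.-integrable `]0, x[ f -> mu.-integrable `]0, x[ (fun s => f (x - s)%R).
Proof.
move=> /integrableP[mf foo]; apply/integrableP; split.
  apply: (@measurable_comp _ _ _ _ _ _ (`]0, x[%classic : set R)) => //.
    by move=> _ [s /=] /[!in_itv]/= /andP[s0 sx] <-; apply/andP; split; lra.
  by apply: measurable_funTS; exact: measurable_refl.
rewrite (integral_itv_refl (f := fun s => `|f s|%E))//.
exact: measurableT_comp.
Qed.

Lemma singularW p q f : p <= q -> singular q f -> singular p f.
Proof.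
move=> pq [mf Cf]; split=> // T T0; have [C C0 fC] := Cf T T0.
exists (C * T `^ (q - p)); first by rewrite mulr_ge0// powR_ge0.
move=> x x0 xT; apply: (le_trans (fC _ x0 xT)).
rewrite -mulrA ler_wpM2l// (_ : q - 1 = (q - p) + (p - 1)); last ring.
rewrite powRD ?(gt_eqF x0) ?implybT// ler_wpM2r ?powR_ge0//.
by apply: ge0_ler_powR; rewrite ?subr_ge0// nnegrE ltW.
Qed.

Lemma singularN q f : singular q f -> singular q (fun x => - f x).
Proof.
move=> [mf Cf]; split; first exact: measurable_funN.
move=> T T0; have [C C0 fC] := Cf T T0; exists C => // x x0 xT.
by rewrite normrN; exact: fC.
Qed.

Lemma singularZ q a f : singular q f -> singular q (fun x => a * f x).
Proof.
move=> [mf Cf]; split; first exact: measurable_funM.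
move=> T T0; have [C C0 fC] := Cf T T0.
exists (`|a| * C); first by rewrite mulr_ge0.
by move=> x x0 xT; rewrite normrM -mulrA ler_wpM2l//; exact: fC.
Qed.

Lemma singularD q f g : singular q f -> singular q g ->
  singular q (fun x => f x + g x).
Proof.
move=> [mf Cf] [mg Cg]; split; first exact: measurable_funD.
move=> T T0; have [C C0 fC] := Cf T T0; have [D D0 gD] := Cg T T0.
exists (C + D); first by rewrite addr_ge0.
move=> x x0 xT; rewrite mulrDl (le_trans (ler_normD _ _))// lerD//.
  exact: fC.
exact: gD.
Qed.

Lemma singularB q f g : singular q f -> singular q g ->
  singular q (fun x => f x - g x).
Proof. by move=> sf sg; apply: singularD => //; exact: singularN. Qed.

Lemma eq_singular q f g : (forall x, 0 < x -> f x = g x) ->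
  singular q f -> singular q g.
Proof.
move=> fg [mf Cf]; split.
  apply: eq_measurable_fun mf => x; rewrite inE/= in_itv/= andbT; exact: fg.
move=> T T0; have [C C0 fC] := Cf T T0; exists C => // x x0 xT.
by rewrite -fg//; exact: fC.
Qed.

Lemma singular_norm q f : singular q f -> singular q (fun x => `|f x|).
Proof.
move=> [mf Cf]; split; first exact: measurableT_comp.
move=> T T0; have [C C0 fC] := Cf T T0; exists C => // x x0 xT.
by rewrite normr_id; exact: fC.
Qed.

Lemma singular_cst (r : R) : singular 1 (cst r).
Proof.
split; first exact: measurable_cst.
by move=> T T0; exists `|r| => // x x0 xT; rewrite subrr powRr0 mulr1.
Qed.

Lemma singular_powR q (r : R) : singular q (fun x => r * x `^ (q - 1)).
Proof.
split.
  by apply: measurable_funM => //; apply/measurable_funTS; exact: measurable_powR.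
move=> T T0; exists `|r| => // x x0 xT.
by rewrite normrM (ger0_norm (powR_ge0 _ _)).
Qed.

Lemma singular_integrable q f (x : R) : 0 < q -> singular q f ->
  mu.-integrable `]0, x[ (EFin \o f).
Proof.
move=> q0 [mf Cf]; have [x0|x0] := ltP 0 x; last first.
  by rewrite set_itv_ge ?bnd_simp -?leNgt//; exact: integrable_set0.
have [C C0 fC] := Cf x x0.
apply: (@le_integrable _ _ _ mu _ _ _ (fun s => C%:E * (s `^ (q - 1))%:E)%E) => //=.
- by apply/measurable_EFinP; exact: measurable_pos_itv.
- move=> s; rewrite in_itv/= => /andP[s0 sx].
  rewrite lee_fin (ger0_norm (mulr_ge0 _ (powR_ge0 _ _)))//.
  by apply: fC => //; exact: ltW.
- by apply: integrableZl => //; exact: integrable_powR_itv.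
Qed.

End singular_class.

Section convolution.
Context {R : realType}.
Local Notation mu := (@lebesgue_measure R).
Local Notation pos := (`]0, +oo[%classic : set R).

Lemma restrict_posE (f : R -> R) x : 0 < x -> (f \_ pos) x = f x.
Proof. by move=> x0; rewrite patchE mem_set//= in_itv/= x0. Qed.

Lemma restrict_pos0 (f : R -> R) x : x <= 0 -> (f \_ pos) x = 0.
Proof. by move=> x0; rewrite patchE memNset//= in_itv/= andbT; apply/negP; rewrite -leNgt. Qed.

Lemma measurable_restrict_pos (f : R -> R) : measurable_fun pos f ->
  measurable_fun setT (f \_ pos).
Proof. by move=> mf; apply/(measurable_restrictT _ _).1. Qed.

Lemma restrict_mul_pos (f h : R -> R) x :
  (fun s => (f \_ pos) (x - s) * (h \_ pos) s) =
  (fun s => f (x - s) * h s) \_ `]0, x[.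
Proof.
apply/funext => s; rewrite [RHS]patchE.
case: ifPn => [|]; rewrite ?inE ?notin_setE/= in_itv/=.
  by move=> /andP[s0 sx]; rewrite !restrict_posE// subr_gt0.
have [s0|s0] := ltP 0 s; last by rewrite (restrict_pos0 h)// mulr0.
by move/negP; rewrite -leNgt => xs; rewrite restrict_pos0 ?mul0r// subr_le0.
Qed.

(** With both factors extended by zero the convolution is an integral over the whole line, so that
    Fubini and translation invariance apply with no domain to track. *)
Lemma convolE (f h : R -> R) x :
  convol f h x = \int[mu]_s ((f \_ pos) (x - s) * (h \_ pos) s).
Proof. by rewrite /convol Rintegral_mkcond restrict_mul_pos. Qed.

Lemma convol_le0 (f h : R -> R) x : x <= 0 -> convol f h x = 0.
Proof.
by move=> x0; rewrite /convol set_itv_ge ?Rintegral_set0// bnd_simp -leNgt.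
Qed.

Lemma eq_convol (f f' h h' : R -> R) x :
  (forall s, 0 < s -> s < x -> f s = f' s) ->
  (forall s, 0 < s -> s < x -> h s = h' s) ->
  convol f h x = convol f' h' x.
Proof.
move=> ff' hh'; apply: eq_Rintegral => s; rewrite inE/= in_itv/= => /andP[s0 sx].
by rewrite ff' ?hh'// ?subr_gt0// ltrBlDr ltrDl.
Qed.

Lemma convol_restrict (f h : R -> R) : (convol f h) \_ pos = convol f h.
Proof.
apply/funext => x; have [x0|x0] := ltP 0 x; first by rewrite restrict_posE.
by rewrite restrict_pos0// convol_le0.
Qed.

(* One of [s] and [x - s] is at least [x / 2]. *)
Lemma mul_powR_le (q x s : R) : q <= 1 -> 0 < s -> s < x ->
  (x - s) `^ (q - 1) * s `^ (q - 1) <=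
  (x / 2) `^ (q - 1) * ((x - s) `^ (q - 1) + s `^ (q - 1)).
Proof.
move=> q1 s0 sx; have [sx2|sx2] := leP s (x / 2).
  apply: (@le_trans _ _ ((x / 2) `^ (q - 1) * s `^ (q - 1))).
    by rewrite ler_wpM2r ?powR_ge0// le_powR_neg//; lra.
  by rewrite ler_wpM2l ?powR_ge0// lerDr powR_ge0.
rewrite mulrC; apply: (@le_trans _ _ ((x / 2) `^ (q - 1) * (x - s) `^ (q - 1))).
  by rewrite ler_wpM2r ?powR_ge0// le_powR_neg//; lra.
by rewrite ler_wpM2l ?powR_ge0// lerDl powR_ge0.
Qed.

(* Bounds the Beta integral [B(q, q)]. *)
Definition beta_bound (q : R) : R := (2^-1) `^ (q - 1) * (2 / q).

Lemma beta_bound_ge0 q : 0 < q -> 0 <= beta_bound q.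
Proof. by move=> q0; rewrite /beta_bound mulr_ge0 ?powR_ge0// divr_ge0// ltW. Qed.

(** After [mul_powR_le] the two powers are integrated separately. The resulting x^(2 q - 1) is kept
    as x^q times x^(q - 1): on (0, T] the first factor is at most T^q, and the second is the order
    required for the class. *)
Lemma integral_convol_bound (q C D x : R) (f h : R -> R) :
  0 < q -> q <= 1 -> 0 <= C -> 0 <= D -> 0 < x ->
  measurable_fun pos f -> measurable_fun pos h ->
  (forall s, 0 < s -> s < x -> `|f s| <= C * s `^ (q - 1)) ->
  (forall s, 0 < s -> s < x -> `|h s| <= D * s `^ (q - 1)) ->
  (\int[mu]_(s in `]0%R, x[) `|f (x - s) * h s|%:E <=
    (C * D * beta_bound q * x `^ q * x `^ (q - 1))%:E)%E.
Proof.
move=> q0 q1 C0 D0 x0 mf mh fC hD.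
have mp : measurable_fun `]0, x[ (fun s : R => (s `^ (q - 1))%:E).
  exact: measurable_powR_itv.
have mpr : measurable_fun `]0, x[ (fun s => ((x - s) `^ (q - 1))%:E).
  apply/measurable_EFinP.
  apply: (measurable_pos_refl (f := fun y => y `^ (q - 1))).
  by apply: measurable_funTS; exact: measurable_powR.
pose K := C * D * (x / 2) `^ (q - 1).
have K0 : 0 <= K by rewrite !mulr_ge0// powR_ge0.
apply: (@le_trans _ _ (\int[mu]_(s in `]0%R, x[)
   (K%:E * (((x - s) `^ (q - 1))%:E + (s `^ (q - 1))%:E)))%E).
  apply: ge0_le_integral => //.
  - apply/measurable_EFinP; apply: measurableT_comp => //; apply: measurable_funM.
      exact: measurable_pos_refl.
    exact: measurable_pos_itv.
  - by apply: measurable_funeM; apply: emeasurable_funD.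
  - move=> s /=; rewrite in_itv/= => /andP[s0 sx].
    rewrite -EFinD -EFinM lee_fin normrM.
    apply: (@le_trans _ _ ((C * (x - s) `^ (q - 1)) * (D * s `^ (q - 1)))).
      by apply: ler_pM => //; [apply: fC; lra|exact: hD].
    rewrite mulrACA /K -[leRHS]mulrA ler_wpM2l ?mulr_ge0//.
    exact: mul_powR_le.
rewrite ge0_integralZl//; last 2 first.
- exact: emeasurable_funD.
- by move=> s _; rewrite adde_ge0// lee_fin powR_ge0.
rewrite ge0_integralD//; last 2 first.
- by move=> s _; rewrite lee_fin powR_ge0.
- by move=> s _; rewrite lee_fin powR_ge0.
rewrite (integral_itv_refl (f := fun s => (s `^ (q - 1))%:E))//.
apply: (@le_trans _ _ (K%:E * ((x `^ q / q)%:E + (x `^ q / q)%:E))%E).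
  by rewrite lee_wpmul2l ?lee_fin// leeD//; exact: integral_powR_itvoo_le.
rewrite -EFinD -EFinM lee_fin /K /beta_bound powRM ?(ltW x0)// ?invr_ge0//.
rewrite le_eqVlt; apply/orP; left; apply/eqP; field; by rewrite gt_eqF.
Qed.

Lemma measurable_convol_itv (x : R) (f h : R -> R) :
  measurable_fun pos f -> measurable_fun pos h ->
  measurable_fun `]0, x[ (fun s => f (x - s) * h s).
Proof.
move=> mf mh.
by apply: measurable_funM; [exact: measurable_pos_refl|exact: measurable_pos_itv].
Qed.

Lemma convol_integrable (q x : R) (f h : R -> R) : 0 < q -> q <= 1 ->
  singular q f -> singular q h ->
  mu.-integrable `]0, x[ (fun s => (f (x - s) * h s)%:E).
Proof.
move=> q0 q1 [mf Cf] [mh Ch].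
have [x0|x0] := ltP 0 x; last first.
  by rewrite set_itv_ge ?bnd_simp -?leNgt//; exact: integrable_set0.
have [C C0 fC] := Cf x x0; have [D D0 hD] := Ch x x0.
apply/integrableP; split; first by apply/measurable_EFinP; exact: measurable_convol_itv.
apply: le_lt_trans (integral_convol_bound q0 q1 C0 D0 x0 mf mh _ _) (ltry _).
  by move=> s s0 sx; apply: fC => //; exact: ltW.
by move=> s s0 sx; apply: hD => //; exact: ltW.
Qed.

Lemma convol_integrableT (q x : R) (f h : R -> R) : 0 < q -> q <= 1 ->
  singular q f -> singular q h ->
  mu.-integrable setT (fun s => ((f \_ pos) (x - s) * (h \_ pos) s)%:E).
Proof.
move=> q0 q1 sf sh; have := convol_integrable x q0 q1 sf sh.
rewrite integrable_mkcond// restrict_EFin -restrict_mul_pos; exact.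
Qed.

(** Tonelli gives the measurability of the integrals of the positive and negative parts as extended
    reals; composing with [fine] covers the parameters at which they are infinite. *)
Lemma measurable_Rintegral_param (G : R * R -> R) : measurable_fun setT G ->
  measurable_fun setT (fun x => \int[mu]_y G (x, y)).
Proof.
move=> mG; apply: (measurableT_comp (f := fine)) => //.
under eq_fun do rewrite integralE.
have mE : measurable_fun setT (EFin \o G) by exact/measurable_EFinP.
have Hp : measurable_fun setT (fun x : R => (\int[mu]_y (EFin \o G)^\+ (x, y))%E).
  by apply: measurable_fun_fubini_tonelli_F => //; exact: measurable_funepos.
have Hn : measurable_fun setT (fun x : R => (\int[mu]_y (EFin \o G)^\- (x, y))%E).
  by apply: measurable_fun_fubini_tonelli_F => //; exact: measurable_funeneg.
apply: emeasurable_funB.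
  by apply: eq_measurable_fun Hp => x _; apply: eq_integral => y _; rewrite !funeposE.
by apply: eq_measurable_fun Hn => x _; apply: eq_integral => y _; rewrite !funenegE.
Qed.

Lemma measurable_convol (f h : R -> R) :
  measurable_fun pos f -> measurable_fun pos h ->
  measurable_fun setT (convol f h).
Proof.
move=> mf mh; rewrite (funext (convolE f h)).
apply: (@measurable_Rintegral_param (fun z => (f \_ pos) (z.1 - z.2) * (h \_ pos) z.2)).
apply: measurable_funM.
  apply: measurableT_comp; first exact: measurable_restrict_pos.
  exact: measurable_funB.
by apply: measurableT_comp; first exact: measurable_restrict_pos.
Qed.

Lemma singular_convol (q : R) (f h : R -> R) : 0 < q -> q <= 1 ->
  singular q f -> singular q h -> singular q (convol f h).
Proof.
move=> q0 q1 sf sh; have [mf Cf] := sf; have [mh Ch] := sh; split.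
  by apply: measurable_funTS; exact: measurable_convol.
move=> T T0; have [C C0 fC] := Cf T T0; have [D D0 hD] := Ch T T0.
exists (C * D * beta_bound q * T `^ q).
  by apply: mulr_ge0 (powR_ge0 _ _); apply: mulr_ge0 (beta_bound_ge0 q0); exact: mulr_ge0.
move=> x x0 xT; have ifh := convol_integrable x q0 q1 sf sh.
rewrite /convol (le_trans (le_normr_Rintegral _ _))//.
apply: (@le_trans _ _ (C * D * beta_bound q * x `^ q * x `^ (q - 1))); last first.
  apply: ler_wpM2r (powR_ge0 _ _) _ _ _; apply: ler_wpM2l.
    by apply: mulr_ge0 (beta_bound_ge0 q0); exact: mulr_ge0.
  by apply: ge0_ler_powR => //; rewrite ?nnegrE ltW.
rewrite -lee_fin /Rintegral fineK; last first.
  by apply: integrable_fin_num => //; exact: (integrable_norm ifh).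
apply: integral_convol_bound => //.
  by move=> s s0 sx; apply: fC => //; rewrite (le_trans (ltW sx)).
by move=> s s0 sx; apply: hD => //; rewrite (le_trans (ltW sx)).
Qed.

End convolution.

(** * Bilinearity and associativity of the convolution *)

Section convolution_algebra.
Context {R : realType}.
Local Notation mu := (@lebesgue_measure R).
Local Notation pos := (`]0, +oo[%classic : set R).
Variable q : R.
Hypotheses (q0 : 0 < q) (q1 : q <= 1).

Lemma convolDr f g h x : singular q f -> singular q g -> singular q h ->
  convol f (fun s => g s + h s) x = convol f g x + convol f h x.
Proof.
move=> sf sg sh; rewrite /convol -RintegralD//; try exact: (convol_integrable x q0 q1).
by apply: eq_Rintegral => s _; rewrite mulrDr.
Qed.

Lemma convolZr f g a x : singular q f -> singular q g ->
  convol f (fun s => a * g s) x = a * convol f g x.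
Proof.
move=> sf sg; rewrite /convol -RintegralZl//; try exact: (convol_integrable x q0 q1).
by apply: eq_Rintegral => s _; rewrite mulrCA.
Qed.

Lemma convolDl f g h x : singular q f -> singular q g -> singular q h ->
  convol (fun s => f s + g s) h x = convol f h x + convol g h x.
Proof.
move=> sf sg sh; have sfg := singularD sf sg.
rewrite !(@convolC _ _ h); try by [case: sf|case: sg|case: sh|case: sfg].
exact: convolDr.
Qed.

Lemma convolZl f g a x : singular q f -> singular q g ->
  convol (fun s => a * f s) g x = a * convol f g x.
Proof.
move=> sf sg; rewrite !(@convolC _ _ g); try by [case: sf|case: sg|case: (singularZ a sf)].
exact: convolZr.
Qed.

Lemma EFin_convol f h x : singular q f -> singular q h ->
  (convol f h x)%:E = (\int[mu]_s ((f \_ pos) (x - s) * (h \_ pos) s)%:E)%E.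
Proof.
move=> sf sh; rewrite convolE /Rintegral fineK//.
by apply: integrable_fin_num => //; exact: convol_integrableT q0 q1 sf sh.
Qed.

Lemma convolA f g h x : singular q f -> singular q g -> singular q h ->
  convol f (convol g h) x = convol (convol f g) h x.
Proof.
move=> sf sg sh; have [x0|x0] := ltP 0 x; last by rewrite !convol_le0.
have sgh := singular_convol q0 q1 sg sh; have sfg := singular_convol q0 q1 sf sg.
have mf := measurable_restrict_pos sf.1; have mg := measurable_restrict_pos sg.1.
have mh := measurable_restrict_pos sh.1.
apply: EFin_inj; rewrite !EFin_convol//.
set f' := f \_ pos; set g' := g \_ pos; set h' := h \_ pos.
pose G (z : R * R) := (f' (x - z.1) * (g' (z.1 - z.2) * h' z.2))%:E.
have mG : measurable_fun setT G.
  apply/measurable_EFinP; apply: measurable_funM.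
    by apply: measurableT_comp mf _; exact: measurable_funB.
  apply: measurable_funM; last exact: measurableT_comp mh _.
  by apply: measurableT_comp mg _; exact: measurable_funB.
have sngh := singular_convol q0 q1 (singular_norm sg) (singular_norm sh).
have nE (u : R -> R) s : `|(u \_ pos) s| = ((fun y => `|u y|) \_ pos) s.
  by rewrite !patchE; case: ifP => // _; rewrite normr0.
have iG : (mu \x mu)%E.-integrable setT G.
  (* The inner integral of |G| is |f| times the convolution of |g| and |h|. That convolution is
     singular again, so the outer integrand is again one of a convolution of singular functions. *)
  apply: (proj2 (@integrable12ltyP _ _ _ _ R mu mu G mG)).
  have H s : (\int[mu]_r `|(f' (x - s) * (g' (s - r) * h' r))%:E| =
      `|f' (x - s) * (convol (fun y => `|g y|) (fun y => `|h y|) \_ pos) s|%:E)%E.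
    under eq_integral do rewrite /= normrM EFinM.
    rewrite integralZl//; last first.
      exact: (integrable_norm (convol_integrableT s q0 q1 sg sh)).
    rewrite normrM EFinM; congr (_ * _)%E.
    rewrite convol_restrict ger0_norm; last by apply: Rintegral_ge0 => r _; exact: mulr_ge0.
    rewrite (EFin_convol _ (singular_norm sg) (singular_norm sh)).
    by apply: eq_integral => r _; rewrite normrM !nE.
  under eq_integral do rewrite H.
  have /integrableP[_] := convol_integrableT x q0 q1 sf sngh.
  by rewrite /=.
have := Fubini iG; rewrite /G /= => Fub.
transitivity (\int[mu]_s \int[mu]_r (f' (x - s) * (g' (s - r) * h' r))%:E)%E.
  apply: eq_integral => s _; under [RHS]eq_integral do rewrite EFinM.
  rewrite integralZl//; last exact: (convol_integrableT s q0 q1 sg sh).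
  by rewrite EFinM convol_restrict EFin_convol.
rewrite Fub; apply: eq_integral => r _.
under eq_integral do rewrite mulrA EFinM.
(* The translation t = s - r turns the inner integral into the convolution of [f] and [g] at x -
   r. *)
pose F (t : R) := (f' (x - r - t) * g' t)%:E.
have FE : (fun s => ((f' (x - s) * g' (s - r))%:E * (h' r)%:E)%E) =
    (fun s => (h' r)%:E * F (s - r)%R)%E.
  apply/funext => s; rewrite muleC /F; congr (_ * (_ * _)%:E)%E; congr f'; ring.
rewrite FE integralZl//; last first.
  have := convol_integrableT (x - r) q0 q1 sf sg; rewrite -/f' -/g' => /integrableP[mF Foo].
  apply/integrableP; split; first by apply: measurableT_comp mF _; exact: measurable_funB.
  rewrite (integral_shift r (f := fun t => `|F t|%E))//; exact: measurableT_comp.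
rewrite (integral_shift r (f := F)); last first.
  exact: measurable_int (convol_integrableT (x - r) q0 q1 sf sg).
by rewrite convol_restrict mulrC EFinM EFin_convol.
Qed.

End convolution_algebra.

(** * Laplace transform *)

Section laplace.
Context {R : realType}.
Local Notation mu := (@lebesgue_measure R).
Local Notation pos := (`]0, +oo[%classic : set R).

Definition laplace_integrable (l : R) (f : R -> R) : Prop :=
  mu.-integrable pos (fun x => (expR (- l * x) * f x)%:E).

Definition laplace (l : R) (f : R -> R) : R :=
  \int[mu]_(x in pos) (expR (- l * x) * f x).

Lemma EFin_laplace l f : laplace_integrable l f ->
  (laplace l f)%:E = (\int[mu]_(x in pos) (expR (- l * x) * f x)%:E)%E.
Proof. by move=> lf; rewrite /laplace /Rintegral fineK//; exact: integrable_fin_num. Qed.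

(** Since exp(- l x) = exp(- l (x - s)) exp(- l s), the weighted convolution is the whole-line
    convolution of the integrable functions [u] and [w], whose integral Fubini splits into a
    product. The class [singular] ensures that the convolution converges at every point. *)
Lemma laplace_convol (q l : R) f h : 0 < q -> q <= 1 ->
  singular q f -> singular q h ->
  laplace_integrable l f -> laplace_integrable l h ->
  laplace_integrable l (convol f h) /\
  laplace l (convol f h) = laplace l f * laplace l h.
Proof.
move=> q0 q1 sf sh lf lh.
pose u := (fun x => expR (- l * x) * f x) \_ pos.
pose w := (fun x => expR (- l * x) * h x) \_ pos.
have iu : mu.-integrable setT (EFin \o u).
  by rewrite /u -restrict_EFin -integrable_mkcond.
have iw : mu.-integrable setT (EFin \o w).
  by rewrite /w -restrict_EFin -integrable_mkcond.
have mu' : measurable_fun setT u by apply/measurable_EFinP; exact: (measurable_int mu).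
have mw : measurable_fun setT w by apply/measurable_EFinP; exact: (measurable_int mu).
pose G (z : R * R) := (u (z.1 - z.2) * w z.2)%:E.
have mG : measurable_fun setT G.
  apply/measurable_EFinP; apply: measurable_funM; last exact: measurableT_comp mw _.
  by apply: measurableT_comp mu' _; exact: measurable_funB.
have iush s : mu.-integrable setT (fun x => (u (x - s))%:E).
  have mU : measurable_fun setT (EFin \o u) by exact/measurable_EFinP.
  apply/integrableP; split.
    by apply: (measurableT_comp mU); exact: measurable_funB.
  rewrite (integral_shift s (f := fun t => `|(u t)%:E|%E)); last exact: measurableT_comp.
  by have /integrableP[] := iu.
have iG : (mu \x mu)%E.-integrable setT G.
  apply: (proj2 (@integrable21ltyP _ _ _ _ R mu mu G mG)).
  have H s : (\int[mu]_x `|(u (x - s) * w s)%:E| = `|w s|%:E * \int[mu]_x `|u x|%:E)%E.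
    under eq_integral do rewrite /= normrM mulrC EFinM.
    rewrite integralZl//; last exact: (integrable_norm (iush s)).
    rewrite (integral_shift s (f := fun t => `|u t|%:E))//.
    by apply/measurable_EFinP; exact: measurableT_comp.
  under eq_integral do rewrite /= H.
  have fu : (\int[mu]_x `|u x|%:E)%E \is a fin_num.
    by apply: integrable_fin_num => //; exact: (integrable_norm iu).
  rewrite -(fineK fu) integralZr//; last exact: (integrable_norm iw).
  apply: lte_mul_pinfty; rewrite ?ltry//.
    by apply: integral_ge0 => x _; rewrite lee_fin.
  by apply: integrable_fin_num => //; exact: (integrable_norm iw).
have GE x : (\int[mu]_s G (x, s) = (expR (- l * x) * convol f h x)%:E)%E.
  rewrite EFinM (EFin_convol q0 q1)// -integralZl//; last first.
    exact: convol_integrableT q0 q1 sf sh.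
  apply: eq_integral => s _; rewrite /G/= /u /w !patchE -EFinM.
  case: ifP; case: ifP => _ _; rewrite ?mulr0 ?mul0r ?mulr0//.
  by rewrite mulrACA -expRD; congr (expR _ * _)%:E; ring.
have FE : fubini_F mu G = (fun x => (expR (- l * x) * convol f h x)%:E).
  by apply/funext => x; rewrite -GE.
have icv : mu.-integrable setT (fun x => (expR (- l * x) * convol f h x)%:E).
  by rewrite -FE; exact: integrable_fubini_F.
split; first by apply: integrableS icv.
apply: EFin_inj; rewrite EFinM !EFin_laplace//; last by apply: integrableS icv.
transitivity (\int[mu]_x (expR (- l * x) * convol f h x)%:E)%E.
  rewrite integral_mkcond; apply: eq_integral => x _; rewrite patchE.
  case: ifPn => //; rewrite notin_setE/= in_itv/= andbT => /negP; rewrite -leNgt => x0.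
  by rewrite convol_le0 ?mulr0.
under eq_integral do rewrite -GE.
rewrite (Fubini iG) /=.
have H s : (\int[mu]_x G (x, s) = (w s)%:E * \int[mu]_x (u x)%:E)%E.
  rewrite /G/=; under eq_integral do rewrite mulrC EFinM.
  rewrite integralZl//; congr (_ * _)%E.
  rewrite (integral_shift s (f := fun t => (u t)%:E))//; exact/measurable_EFinP.
under eq_integral do rewrite H.
rewrite -(fineK (integrable_fin_num _ iu))// integralZr// muleC.
rewrite (fineK (integrable_fin_num _ iu))//.
rewrite [in RHS]integral_mkcond restrict_EFin; congr (_ * _)%E.
by rewrite [in RHS]integral_mkcond restrict_EFin.
Qed.

End laplace.

(** * Injectivity of the Laplace transform *)

Section laplace_uniqueness.
Context {R : realType}.
Local Notation mu := (@lebesgue_measure R).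
Local Notation pos := (`]0, +oo[%classic : set R).

Lemma integrableZl_EFin (D : set R) (k : R) (f : R -> R) : measurable D ->
  mu.-integrable D (EFin \o f) -> mu.-integrable D (fun x => (k * f x)%:E).
Proof.
move=> mD iF; rewrite (_ : (fun x => _) = (fun x => k%:E * (EFin \o f) x)%E)//.
exact: integrableZl.
Qed.

Lemma integrableD_EFin (D : set R) (f g : R -> R) : measurable D ->
  mu.-integrable D (EFin \o f) -> mu.-integrable D (EFin \o g) ->
  mu.-integrable D (fun x => (f x + g x)%:E).
Proof.
move=> mD iF ig; rewrite (_ : (fun x => _) = (EFin \o f) \+ (EFin \o g))%E//.
exact: integrableD.
Qed.

Lemma integrableB_EFin (D : set R) (f g : R -> R) : measurable D ->
  mu.-integrable D (EFin \o f) -> mu.-integrable D (EFin \o g) ->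
  mu.-integrable D (fun x => (f x - g x)%:E).
Proof.
move=> mD iF ig; rewrite (_ : (fun x => _) = (EFin \o f) \- (EFin \o g))%E//.
exact: integrableB.
Qed.

Lemma near_ball (f : R -> R) (x e : R) : {for x, continuous f} -> 0 < e ->
  exists2 d : R, 0 < d & forall y, `|x - y| < d -> `|f x - f y| < e.
Proof.
by move=> /cvgrPdist_lt /[apply] /nbhs_ballP[d /= d0 H]; exists d => // y xy; exact: H.
Qed.

Lemma integrable_expM (l : R) (h : R -> R) : 0 <= l ->
  mu.-integrable pos (EFin \o h) ->
  mu.-integrable pos (fun x => (expR (- l * x) * h x)%:E).
Proof.
move=> l0 ih; apply: (le_integrable _ _ _ ih) => //.
  apply/measurable_EFinP; apply: measurable_funM.
    apply: measurableT_comp => //; exact: measurable_funM.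
  by apply/measurable_EFinP; exact: (measurable_int mu).
move=> x /=; rewrite in_itv/= andbT => x0; rewrite lee_fin normrM ler_piMl//.
by rewrite ger0_norm ?expR_ge0// expR_le1 mulNr oppr_le0 mulr_ge0// ltW.
Qed.

Lemma moments_poly (h : R -> R) : mu.-integrable pos (EFin \o h) ->
  (forall n, \int[mu]_(x in pos) (expR (- n%:R * x) * h x) = 0) ->
  forall p : {poly R},
    mu.-integrable pos (fun x => (p.[expR (- x)] * h x)%:E) /\
    \int[mu]_(x in pos) (p.[expR (- x)] * h x) = 0.
Proof.
move=> ih h0 p.
(* The extra factor exp(- k x) makes the induction go through: multiplying the polynomial by the
   indeterminate raises [k] by one. *)
suff : forall (p : {poly R}) k,
    mu.-integrable pos (fun x => (p.[expR (- x)] * (expR (- k%:R * x) * h x))%:E) /\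
    \int[mu]_(x in pos) (p.[expR (- x)] * (expR (- k%:R * x) * h x)) = 0.
  move=> /(_ p 0%N) [H1 H2]; split.
    apply: eq_integrable H1 => // x _.
    by rewrite oppr0 mul0r expR0 mul1r.
  by rewrite -[RHS]H2; apply: eq_Rintegral => x _; rewrite oppr0 mul0r expR0 mul1r.
move=> {}p; elim/poly_ind: p => [k|p c IH k].
  have Z : (fun x => ((0 : {poly R}).[expR (- x)] * (expR (- k%:R * x) * h x))%:E) = cst 0%E.
    by apply/funext => x; rewrite horner0 mul0r.
  by rewrite /Rintegral Z integral0; split=> //; exact: integrable0.
have [i1 z1] := IH k.+1.
have i2 : mu.-integrable pos (fun x => (expR (- k%:R * x) * h x)%:E).
  exact: integrable_expM.
have E x : (p * 'X + c%:P).[expR (- x)] * (expR (- k%:R * x) * h x) =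
    p.[expR (- x)] * (expR (- k.+1%:R * x) * h x) + c * (expR (- k%:R * x) * h x).
  rewrite hornerMXaddC mulrDl; congr (_ + _); rewrite -!mulrA; congr (_ * _).
  by rewrite mulrA -expRD; congr (expR _ * _); rewrite -natr1; ring.
have EF : (fun x => ((p * 'X + c%:P).[expR (- x)] * (expR (- k%:R * x) * h x))%:E) =
    (fun x => (p.[expR (- x)] * (expR (- k.+1%:R * x) * h x))%:E +
              c%:E * (expR (- k%:R * x) * h x)%:E)%E.
  by apply/funext => x; rewrite E.
split; first by rewrite EF; apply: integrableD => //; exact: integrableZl.
rewrite /Rintegral EF integralD//; last exact: integrableZl.
rewrite fineD ?integrable_fin_num//; last exact: integrableZl.
rewrite integralZl// fineM ?integrable_fin_num//.
by rewrite [X in X + _]z1 [X in _ * X]h0 mulr0 addr0.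
Qed.

(* Integrating [h] against the powers of a polynomial in [exp (- x)] peaked at
   [x0] isolates the sign of [h x0]. *)
Lemma moments_le0 (h : R -> R) (x0 : R) : mu.-integrable pos (EFin \o h) ->
  (forall n, \int[mu]_(x in pos) (expR (- n%:R * x) * h x) = 0) ->
  0 < x0 -> {for x0, continuous h} -> h x0 <= 0.
Proof.
move=> ih h0 x00 ch; rewrite leNgt; apply/negP => hx0.
pose eta := h x0 / 2; have eta0 : 0 < eta by rewrite divr_gt0.
have [d1 d10 Hd1] := near_ball ch eta0.
pose d := Num.min d1 x0.
have dgt0 : 0 < d by rewrite lt_min d10.
have dd1 : d <= d1 by rewrite ge_min lexx.
have dx0 : d <= x0 by rewrite ge_min lexx orbT.
pose t0 := expR (- x0).
have t00 : 0 < t0 by exact: expR_gt0.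
have t01 : t0 < 1 by rewrite expR_lt1 oppr_lt0.
(* By monotonicity of the exponential, exp(- x) stays at distance at least [m] from [t0] once x is
   at distance at least [d] from [x0]. *)
pose m := Num.min (t0 - expR (- (x0 + d))) (expR (- (x0 - d)) - t0).
have m0 : 0 < m.
  by rewrite lt_min !subr_gt0 !ltr_expR !ltrN2 ltrDl dgt0/= ltrBlDr ltrDl.
have m1 : m < 1.
  rewrite (@le_lt_trans _ _ (t0 - expR (- (x0 + d))))// ?ge_min ?lexx//.
  by have := expR_gt0 (- (x0 + d)); lra.
have far x : 0 < x -> d <= `|x0 - x| -> m <= `|expR (- x) - t0|.
  move=> xgt0; rewrite ler_normr => /orP[dx|dx].
    apply: (@le_trans _ _ (expR (- x) - t0)); last exact: ler_norm.
    rewrite (@le_trans _ _ (expR (- (x0 - d)) - t0))// ?ge_min ?lexx ?orbT//.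
    by rewrite lerD2r ler_expR; lra.
  rewrite distrC; apply: (@le_trans _ _ (t0 - expR (- x))); last exact: ler_norm.
  rewrite (@le_trans _ _ (t0 - expR (- (x0 + d))))// ?ge_min ?lexx//.
  by rewrite lerD2l lerN2 ler_expR; lra.
have ce : {for x0, continuous (fun x : R => expR (- x))}.
  by apply: continuous_comp; [exact: opp_continuous|exact: continuous_expR].
have m20 : 0 < m / 2 by rewrite divr_gt0.
have [e1 e10 He1] := near_ball ce m20.
pose e := Num.min e1 d.
have egt0 : 0 < e by rewrite lt_min e10.
have ee1 : e <= e1 by rewrite ge_min lexx.
have ed : e <= d by rewrite ge_min lexx orbT.
(* This polynomial takes values in [0, 1] on (0, 1) with maximum 1 at [t0]. It is at least [A]
   within m / 2 of [t0] and at most [B] < [A] at distance [m] or more. *)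
pose p : {poly R} := 1 - ('X - t0%:P) ^+ 2.
have pE x : p.[expR (- x)] = 1 - (expR (- x) - t0) ^+ 2.
  by rewrite /p !hornerE.
pose A := 1 - (m / 2) ^+ 2; pose B := 1 - m ^+ 2.
have B0 : 0 <= B by rewrite subr_ge0 expr_le1// ltW.
have AB : B < A by rewrite /A /B; nra.
have A0 : 0 < A by exact: le_lt_trans AB.
have p01 x : 0 < x -> 0 <= p.[expR (- x)].
  move=> xgt0; have := expR_gt0 (- x); have : expR (- x) < 1 by rewrite expR_lt1 oppr_lt0.
  by rewrite pE => ? ?; nra.
have pfar x : 0 < x -> d <= `|x0 - x| -> p.[expR (- x)] <= B.
  move=> xgt0 dx; rewrite pE lerD2l lerN2 -[leRHS](real_normK (num_real _)).
  by rewrite ler_sqr ?nnegrE ?(ltW m0)//; exact: far.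
have pnear x : `|x0 - x| < e -> A <= p.[expR (- x)].
  move=> xe; rewrite pE lerD2l lerN2 -[leLHS](real_normK (num_real _)).
  rewrite ler_sqr ?nnegrE ?(ltW m20)// distrC ltW//; apply: He1.
  exact: lt_le_trans ee1.
pose N : set R := `]x0 - e, x0 + e[%classic.
have Npos : N `<=` pos.
  move=> x /=; rewrite !in_itv/= andbT => /andP[+ _]; apply: le_lt_trans; lra.
have NE x : (x \in N) = (`|x0 - x| < e).
  by apply/idP/idP; rewrite inE /N/= in_itv/= ltr_norml => /andP[? ?]; apply/andP; split; lra.
have muN : mu N = (e *+ 2)%:E.
  transitivity (((x0 + e) - (x0 - e))%:E : \bar R); last by congr EFin; ring.
  rewrite lebesgue_measure_itv/= lte_fin ifT//; lra.
pose H := \int[mu]_(x in pos) `|h x|.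
have key n : A ^+ n * (eta * (e *+ 2)) <= B ^+ n * H.
  have [ipn zpn] := moments_poly ih h0 (p ^+ n).
  have inh := integrable_norm ih.
  have iN : mu.-integrable pos (EFin \o (\1_N : R -> R)).
    by apply: integrableS (integrable_indic_itv _ _ _ _).
  suff : A ^+ n * eta * \int[mu]_(x in pos) (\1_N x) - B ^+ n * H <= 0.
    rewrite subr_le0; apply: le_trans; rewrite -mulrA; do 2 (rewrite ler_pM2l ?exprn_gt0//).
    rewrite /Rintegral integral_indic//; last exact: measurable_itv.
    by rewrite setIidl// [X in fine X]muN.
  rewrite -[leRHS]zpn -!RintegralZl// -RintegralB//; last 2 first.
  - exact: integrableZl_EFin.
  - exact: (integrableZl_EFin _ _ inh).
  apply: le_Rintegral => //.
    apply: integrableB_EFin => //; first exact: integrableZl_EFin.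
    exact: (integrableZl_EFin _ _ inh).
  move=> x /=; rewrite in_itv/= andbT => xgt0; rewrite horner_exp.
  have pn0 : 0 <= p.[expR (- x)] ^+ n by rewrite exprn_ge0// p01.
  have Bn0 : 0 <= B ^+ n by rewrite exprn_ge0.
  have nh : 0 <= B ^+ n * `|h x| by rewrite mulr_ge0.
  rewrite indicE; have [xd|xd] := ltP `|x0 - x| d; last first.
    rewrite NE ltNge (le_trans ed xd)/= mulr0 sub0r.
    apply: (@le_trans _ _ (- (p.[expR (- x)] ^+ n * `|h x|))).
      by rewrite lerN2 ler_wpM2r// lerXn2r ?nnegrE ?p01// pfar.
    by rewrite lerNl -mulrN ler_wpM2l// -normrN ler_norm.
  have hx : eta <= h x.
    have := Hd1 x (lt_le_trans xd dd1); rewrite ltr_norml => /andP[_].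
    by rewrite /eta; lra.
  rewrite NE; case: ltP => xe; last first.
    by rewrite mulr0 sub0r (@le_trans _ _ 0)// ?oppr_le0// mulr_ge0// (le_trans (ltW eta0)).
  rewrite mulr1 (@le_trans _ _ (A ^+ n * eta))// ?gerBl//.
  apply: ler_pM => //; rewrite ?exprn_ge0 ?(ltW A0) ?(ltW eta0)//.
  by rewrite lerXn2r ?nnegrE ?p01 ?(ltW A0)// pnear.
pose C := eta * (e *+ 2).
have C0 : 0 < C by rewrite mulr_gt0// mulrn_wgt0.
have BA : `|B / A| < 1.
  by rewrite ger0_norm ?divr_ge0 ?(ltW A0)// ltr_pdivrMr// mul1r.
have : C <= 0.
  have lim0 : (fun n => (B / A) ^+ n * H) @ \oo --> 0 * H.
    by apply: cvgMl; exact: cvg_expr.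
  rewrite mul0r in lim0; apply: (cvgr_to_ge lim0); apply: nearW => n.
  have An : 0 < A ^+ n by rewrite exprn_gt0.
  by rewrite expr_div_n mulrAC ler_pdivlMr// mulrC; exact: key.
by rewrite leNgt C0.
Qed.

(** The values of the transform at [l0 + n] are the integrals of exp(- l0 x) f(x) against the powers
    of exp(- x), so [moments_le0] applies to this weighted function and to its opposite. *)
Lemma laplace_inj (l0 : R) (f : R -> R) : {in pos, continuous f} ->
  laplace_integrable l0 f -> (forall l, l0 <= l -> laplace l f = 0) ->
  forall x, 0 < x -> f x = 0.
Proof.
move=> cf lf f0 x x0; pose h (y : R) := expR (- l0 * y) * f y.
have ih : mu.-integrable pos (EFin \o h) by [].
have h0 n : \int[mu]_(x in pos) (expR (- n%:R * x) * h x) = 0.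
  rewrite -[RHS](f0 (l0 + n%:R)) ?lerDl//; apply: eq_Rintegral => y _.
  by rewrite /h mulrA -expRD; congr (expR _ * _); ring.
have ch : {for x, continuous h}.
  apply: continuousM; last by apply: cf; rewrite inE/= in_itv/= x0.
  apply: continuous_comp; last exact: continuous_expR.
  exact: mulrl_continuous.
have chN : {for x, continuous (fun y => - h y)} by exact: continuousN.
have hle : h x <= 0 by exact: moments_le0.
have hge : - h x <= 0.
  apply: (@moments_le0 (fun y => - h y)) => //.
    rewrite (_ : _ \o _ = fun x => (-1 * h x)%:E); last first.
      by apply/funext => y; rewrite /= mulN1r.
    exact: integrableZl_EFin.
  move=> n; have ihn : mu.-integrable pos (fun x => (expR (- n%:R * x) * h x)%:E).
    exact: integrable_expM.
  transitivity (-1 * \int[mu]_(x in pos) (expR (- n%:R * x) * h x)); last by rewrite h0 mulr0.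
  rewrite -RintegralZl//.
  by apply: eq_Rintegral => y _; rewrite mulN1r mulrN.
have : h x = 0 by apply/eqP; rewrite eq_le hle -oppr_le0.
by move/eqP; rewrite mulf_eq0 expR_eq0/= => /eqP.
Qed.

End laplace_uniqueness.

(** * Fractional kernels *)

Section gamma.
Context {R : realType}.
Local Notation mu := (@lebesgue_measure R).
Local Notation pos := (`]0, +oo[%classic : set R).

Lemma measurable_powRD (D : set R) (p : R) : measurable_fun D (fun x : R => x `^ p).
Proof. by apply/measurable_funTS; exact: measurable_powR. Qed.

Lemma measurable_expRD (D : set R) (l : R) :
  measurable_fun D (fun x : R => expR (- l * x)).
Proof.
by apply/measurable_funTS; apply: measurableT_comp => //; exact: measurable_funM.
Qed.

Lemma measurable_expRN (D : set R) : measurable_fun D (fun x : R => expR (- x)).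
Proof.
rewrite (_ : (fun x => _) = fun x => expR (- 1 * x)); first exact: measurable_expRD.
by apply/funext => x; rewrite mulN1r.
Qed.

Lemma exp_integral : mu.-integrable pos (fun x => (expR (- x))%:E) /\
  (\int[mu]_(x in pos) (expR (- x))%:E = 1)%E.
Proof.
have E x : 0 <= x -> exponential_pdf 1 x = expR (- x) :> R.
  by move=> x0; rewrite exponential_pdfE// mul1r mulN1r.
split.
  apply: (@eq_integrable _ _ _ mu pos _ (EFin \o exponential_pdf 1)) => //.
    by move=> x; rewrite inE/= in_itv/= andbT => /ltW /E /= ->.
  by apply: integrableS (integrable_exponential_pdf _).
rewrite integral_itv_obnd_cbnd; last first.
  apply/measurable_EFinP; exact: measurable_expRN.
rewrite -(@integral_exponential_pdf R 1)// integral_mkcond.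
apply: eq_integral => x _; rewrite patchE; case: ifPn.
  by rewrite inE/= in_itv/= andbT => /E ->.
rewrite notin_setE/= in_itv/= andbT => /negP; rewrite -ltNge => x0.
by rewrite lt0_exponential_pdf.
Qed.

Section gamma_function.
Variable z : R.
Hypotheses (z0 : 0 < z) (z1 : z <= 1).

Lemma gamma_integrable :
  mu.-integrable pos (fun t => (t `^ (z - 1) * expR (- t))%:E).
Proof.
have ip : mu.-integrable pos ((fun t : R => (t `^ (z - 1))%:E) \_ `]0, 1[).
  apply/integrable_restrict => //; rewrite setIidr; last exact: subitv_pos.
  exact: integrable_powR_itv.
have mf : measurable_fun pos (fun t : R => (t `^ (z - 1) * expR (- t))%:E).
  apply/measurable_EFinP; apply: measurable_funM.
    exact: measurable_powRD.
  exact: measurable_expRN.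
(* Since z <= 1, the integrand is at most t^(z - 1) on (0, 1) and at most exp(- t) beyond. *)
have iD : mu.-integrable pos
    (((fun t : R => (t `^ (z - 1))%:E) \_ `]0%R, 1%R[) \+ (fun t : R => (expR (- t))%:E))%E.
  by apply: integrableD => //; exact: exp_integral.1.
apply: le_integrable iD => //.
move=> t /=; rewrite in_itv/= andbT => t0.
rewrite patchE ger0_norm ?mulr_ge0 ?powR_ge0 ?expR_ge0//.
case: ifPn => [_|].
  rewrite /= lee_fin ger0_norm ?addr_ge0 ?powR_ge0 ?expR_ge0//.
  rewrite (@le_trans _ _ (t `^ (z - 1)))// ?lerDl ?expR_ge0//.
  by rewrite ler_piMr ?powR_ge0// expR_le1 oppr_le0 ltW.
rewrite notin_setE/= in_itv/= t0/= => /negP; rewrite -leNgt => t1.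
rewrite add0r lee_fin (ger0_norm (expR_ge0 _)) ler_piMl ?expR_ge0//.
by rewrite -[leRHS](powRr0 t); apply: ler_powR => //; rewrite subr_le0.
Qed.

Lemma EFin_Gamma :
  (Gamma z)%:E = (\int[mu]_(t in pos) (t `^ (z - 1) * expR (- t))%:E)%E.
Proof.
by rewrite /Gamma /Rintegral fineK//; exact: integrable_fin_num gamma_integrable.
Qed.

Lemma Gamma_gt0 : 0 < Gamma z.
Proof.
rewrite -lte_fin EFin_Gamma.
pose m : R := 2 `^ (z - 1) * expR (- 2).
have mI : mu (`]1, 2[%classic : set R) = 1%E.
  by rewrite lebesgue_measure_itv/= lte_fin ltr1n -EFinB; congr EFin; lra.
have m0 : 0 < m by rewrite mulr_gt0 ?powR_gt0 ?expR_gt0.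
apply: (@lt_le_trans _ _ (\int[mu]_(t in `]1%R, 2%R[) m%:E)%E).
  by rewrite integral_cst// [X in (_ * X)%E]mI mule1 lte_fin.
apply: (@le_trans _ _ (\int[mu]_(t in `]1%R, 2%R[) (t `^ (z - 1) * expR (- t))%:E)%E).
  apply: ge0_le_integral => //.
  - by move=> t _; rewrite lee_fin ltW.
  - apply: measurable_funS (measurable_int mu gamma_integrable) => //.
    by move=> t /=; rewrite !in_itv/= andbT => /andP[]; lra.
  - move=> t /=; rewrite in_itv/= => /andP[t1 t2]; rewrite lee_fin /m.
    apply: ler_pM; rewrite ?powR_ge0 ?expR_ge0//; last by rewrite ler_expR; lra.
    by apply: le_powR_neg => //; lra.
apply: ge0_subset_integral => //.
- exact: (measurable_int mu gamma_integrable).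
- by move=> t _; rewrite lee_fin mulr_ge0 ?powR_ge0 ?expR_ge0.
- by move=> t /=; rewrite !in_itv/= andbT => /andP[]; lra.
Qed.

Lemma laplace_powR (r l : R) : 0 < l ->
  laplace_integrable l (fun x => r * x `^ (z - 1)) /\
  laplace l (fun x => r * x `^ (z - 1)) = r * (Gamma z * l `^ (- z)).
Proof.
move=> l0.
pose f := (fun t : R => t `^ (z - 1) * expR (- t)) \_ pos.
have f0 t : 0 <= f t.
  by rewrite /f patchE; case: ifP => // _; rewrite mulr_ge0 ?powR_ge0 ?expR_ge0.
have mf : measurable_fun setT (EFin \o f).
  rewrite /f -restrict_EFin; apply/(measurable_restrictT _ _).1 => //.
  exact: (measurable_int mu gamma_integrable).
have fE x : f (l * x) = l `^ (z - 1) * ((fun x => expR (- l * x) * x `^ (z - 1)) \_ pos) x.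
  have [x0|x0] := ltP 0 x; last by rewrite /f !restrict_pos0 ?mulr0// pmulr_rle0.
  rewrite /f !restrict_posE ?mulr_gt0// powRM ?(ltW x0) ?(ltW l0)//.
  by rewrite mulNr -!mulrA; congr (_ * _); rewrite mulrC.
pose g := (fun x => expR (- l * x) * x `^ (z - 1)).
have mg : measurable_fun pos (EFin \o g).
  apply/measurable_EFinP; apply: measurable_funM; last first.
    exact: measurable_powRD.
  exact: measurable_expRD.
have mgT : measurable_fun setT (EFin \o (g \_ pos)).
  by rewrite -restrict_EFin; apply/(measurable_restrictT _ _).1.
have g0 x : 0 <= g x by rewrite mulr_ge0 ?powR_ge0 ?expR_ge0.
have H : (\int[mu]_(x in pos) (g x)%:E = (Gamma z * l `^ (- z))%:E)%E.
  rewrite EFinM EFin_Gamma integral_mkcond [in RHS]integral_mkcond !restrict_EFin.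
  rewrite -/f (ge0_integral_scale l0 mf)//.
  under [in RHS]eq_integral do rewrite /= fE EFinM.
  have gp0 x : (0 <= ((g \_ pos) x)%:E)%E.
    by rewrite lee_fin patchE; case: ifP.
  rewrite ge0_integralZl ?lee_fin ?powR_ge0//.
  rewrite muleA -EFinM mulr_powRB1 ?(ltW l0)// muleAC -EFinM.
  by rewrite powRN divff ?mul1e// gt_eqF// powR_gt0.
have ig : mu.-integrable pos (EFin \o g).
  apply/integrableP; split => //; under eq_integral do rewrite /= ger0_norm//.
  by rewrite H ltry.
have E x : expR (- l * x) * (r * x `^ (z - 1)) = r * g x by rewrite mulrCA.
rewrite /laplace_integrable /laplace; split.
  rewrite (_ : (fun x => _) = (fun x => (r * g x)%:E)); last first.
    by apply/funext => x; rewrite E.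
  exact: integrableZl_EFin.
under eq_Rintegral do rewrite E.
by rewrite RintegralZl//; congr (_ * _); rewrite /Rintegral H.
Qed.

End gamma_function.

Lemma Gamma1 : Gamma (1 : R) = 1.
Proof.
apply: EFin_inj; rewrite EFin_Gamma// -exp_integral.2.
by apply: eq_integral => x _; rewrite subrr powRr0 mul1r.
Qed.

Lemma laplace_cst (r l : R) : 0 < l ->
  laplace_integrable l (cst r) /\ laplace l (cst r) = r / l.
Proof.
move=> l0; have [] := @laplace_powR 1 ltr01 (lexx 1) r l l0.
rewrite Gamma1 mul1r powR_inv1 ?(ltW l0)// (_ : (fun x => _) = cst r)//.
by apply/funext => x; rewrite subrr powRr0 mulr1.
Qed.

End gamma.

(** * The Sonine identity for the two kernels *)

Section sonine.
Context {R : realType}.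
Local Notation mu := (@lebesgue_measure R).
Local Notation pos := (`]0, +oo[%classic : set R).

(** Scaling the integration variable by x extracts the power. What remains, the value at 1, is the
    Beta integral B(p, t), left unevaluated. *)
Lemma convol_powR (p t x : R) : 0 < p -> p <= 1 -> 0 < t -> t <= 1 -> 0 < x ->
  convol (fun y => y `^ (p - 1)) (fun y => y `^ (t - 1)) x =
  x `^ (p + t - 1) * convol (fun y => y `^ (p - 1)) (fun y => y `^ (t - 1)) 1.
Proof.
move=> p0 p1 t0 t1 x0; rewrite !convolE /Rintegral.
set f := (fun y : R => y `^ (p - 1)) \_ pos; set h := (fun y : R => y `^ (t - 1)) \_ pos.
have f0 y : 0 <= f y by rewrite /f patchE; case: ifP => // _; exact: powR_ge0.
have h0 y : 0 <= h y by rewrite /h patchE; case: ifP => // _; exact: powR_ge0.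
have mf : measurable_fun setT f by apply: measurable_restrict_pos; exact: measurable_powRD.
have mh : measurable_fun setT h by apply: measurable_restrict_pos; exact: measurable_powRD.
have mF (y : R) : measurable_fun setT (fun s : R => (f (y - s) * h s)%:E).
  apply/measurable_EFinP; apply: measurable_funM => //.
  by apply: measurableT_comp mf _; exact: measurable_funB.
rewrite (ge0_integral_scale x0 (mF x)); last by move=> s; rewrite lee_fin mulr_ge0.
have sc (r : R) y : ((fun y : R => y `^ r) \_ pos) (x * y) =
    x `^ r * ((fun y : R => y `^ r) \_ pos) y.
  have [y0|y0] := ltP 0 y; last by rewrite !restrict_pos0 ?mulr0// pmulr_rle0.
  by rewrite !restrict_posE ?mulr_gt0// powRM ?ltW.
have FE s : f (x - x * s) * h (x * s) = x `^ (p - 1) * x `^ (t - 1) * (f (1 - s) * h s).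
  by rewrite -[X in X - _]mulr1 -mulrBr /f /h !sc mulrACA.
have -> : (\int[mu]_s (f (x - x * s) * h (x * s))%:E =
    (x `^ (p - 1) * x `^ (t - 1))%:E * \int[mu]_s (f (1 - s) * h s)%:E)%E.
  rewrite -ge0_integralZl//.
  - by apply: eq_integral => s _; rewrite -EFinM; congr EFin; exact: FE.
  - exact: mF.
  - by move=> s _; rewrite lee_fin mulr_ge0.
  - by rewrite lee_fin mulr_ge0 ?powR_ge0.
rewrite muleA -EFinM (_ : x * _ = x `^ (p + t - 1)); last first.
  rewrite -{1}(powRr1 (ltW x0)) -!powRD ?(gt_eqF x0) ?implybT//.
  by congr (_ `^ _); ring.
rewrite fineM//; apply: integrable_fin_num => //.
pose q := Num.min p t; have q0 : 0 < q by rewrite lt_min p0.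
have q1 : q <= 1 by rewrite ge_min p1.
have sp : singular q (fun y => y `^ (p - 1)).
  apply: (@singularW _ _ p); first by rewrite ge_min lexx.
  by apply: eq_singular (singular_powR p 1) => y _; rewrite mul1r.
have st : singular q (fun y => y `^ (t - 1)).
  apply: (@singularW _ _ t); first by rewrite ge_min lexx orbT.
  by apply: eq_singular (singular_powR t 1) => y _; rewrite mul1r.
exact: convol_integrableT q0 q1 sp st.
Qed.

(** The kernel of the fractional integral of order [a], divided by [c]; it is the Sonine partner of
    [L_K a c]. *)
Definition frac_kernel (a c : R) : R -> R :=
  fun x => (c * Gamma a)^-1 * x `^ (a - 1).

Variables a c : R.
Hypotheses (a0 : 0 < a) (a1 : a < 1) (c0 : 0 < c).

Let b0 : 0 < 1 - a. Proof. by rewrite subr_gt0. Qed.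
Let b1 : 1 - a <= 1. Proof. by rewrite gerBl ltW. Qed.

Lemma L_KE : L_K a c = fun x => (c / Gamma (1 - a)) * x `^ ((1 - a) - 1).
Proof.
apply/funext => x; rewrite /L_K mulrAC; congr (_ * _ `^ _); ring.
Qed.

(* A common exponent for [L_K], of order [x^-a] at 0, and for the functions of
   order [x^(a - 1)]. *)
Definition sing_exp : R := Num.min a (1 - a).

Lemma sing_exp_gt0 : 0 < sing_exp.
Proof. by rewrite lt_min a0. Qed.

Lemma sing_exp_le1 : sing_exp <= 1.
Proof. by rewrite ge_min (ltW a1). Qed.

Lemma singular_L_K : singular sing_exp (L_K a c).
Proof.
rewrite L_KE; apply: (@singularW _ _ (1 - a)); last exact: singular_powR.
by rewrite ge_min lexx orbT.
Qed.

Lemma singular_frac_kernel : singular a (frac_kernel a c).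
Proof. exact: singular_powR. Qed.

Lemma singular_frac_kernel' : singular sing_exp (frac_kernel a c).
Proof. by apply: singularW singular_frac_kernel; rewrite ge_min lexx. Qed.

Lemma laplace_frac_kernel l : 0 < l -> laplace_integrable l (frac_kernel a c) /\
  laplace l (frac_kernel a c) = (c * l `^ a)^-1.
Proof.
move=> l0; have [h1 h2] := laplace_powR a0 (ltW a1) (c * Gamma a)^-1 l0.
split=> //; rewrite /frac_kernel h2 powRN.
have G0 := Gamma_gt0 a0 (ltW a1); have l1 := powR_gt0 a l0.
by field; rewrite !gt_eqF.
Qed.

(** The exponents (1 - a) and a add up to 1, so by scaling the convolution is constant on (0, oo).
    Laplace transforms at l = 1 identify the constant: those of the kernels are c and 1 / c, and
    that of a constant is the constant itself. This replaces the Beta function and the evaluation of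
    Gamma(a) Gamma(1 - a). *)
Lemma convol_sonine x : 0 < x -> convol (L_K a c) (frac_kernel a c) x = 1.
Proof.
have q0 := sing_exp_gt0; have q1 := sing_exp_le1.
have sL := singular_L_K; have sk := singular_frac_kernel'.
have Ga := Gamma_gt0 a0 (ltW a1); have Gb := Gamma_gt0 b0 b1.
have E x0 : 0 < x0 -> convol (L_K a c) (frac_kernel a c) x0 =
    convol (L_K a c) (frac_kernel a c) 1.
  move=> x00; have sa : singular sing_exp (fun y => y `^ (a - 1)).
    apply: (@singularW _ _ a); first by rewrite ge_min lexx.
    by apply: eq_singular (singular_powR a 1) => y _; rewrite mul1r.
  have sb : singular sing_exp (fun y => y `^ ((1 - a) - 1)).
    apply: (@singularW _ _ (1 - a)); first by rewrite ge_min lexx orbT.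
    by apply: eq_singular (singular_powR (1 - a) 1) => y _; rewrite mul1r.
  rewrite L_KE /frac_kernel.
  rewrite !(convolZl q0 q1 _ _ sb (singularZ _ sa)) !(convolZr q0 q1 _ _ sb sa).
  rewrite (convol_powR b0 b1 a0 (ltW a1) x00).
  by rewrite (_ : 1 - a + a - 1 = 0) ?powRr0 ?mul1r//; ring.
set B := convol (L_K a c) (frac_kernel a c) 1 in E.
move=> x0; rewrite E//.
have := laplace_powR b0 b1 (c / Gamma (1 - a)) ltr01; rewrite -L_KE => -[hL1].
rewrite powR1 mulr1 divfK ?gt_eqF// => hL2.
have [hk1 hk2] := laplace_frac_kernel ltr01.
have [_] := laplace_convol q0 q1 sL sk hL1 hk1.
rewrite hL2 hk2 powR1 mulr1 divff ?gt_eqF// => <-.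
have [_] := laplace_cst B (ltr01 : 0 < 1 :> R); rewrite divr1 => <-.
apply: eq_Rintegral => y; rewrite inE/= in_itv/= andbT => y0.
by rewrite E.
Qed.

End sonine.

(** * Primitives and absolute continuity *)

Section primitive.
Context {R : realType}.
Local Notation mu := (@lebesgue_measure R).
Local Notation pos := (`]0, +oo[%classic : set R).
(** [abs_continuous] constrains open intervals but takes increments at their endpoints. Degenerate
    intervals are empty and tell nothing of theirs, whence the strict inequality. *)
Lemma subitv_endpoints (p r u w : R) : u < w -> `]u, w[ `<=` `[p, r] -> p <= u /\ w <= r.
Proof.
move=> uw sub; split; rewrite leNgt; apply/negP => h.
  have um : u < Num.min p w by rewrite lt_min h.
  pose y := (u + Num.min p w) / 2.
  have uy : u < y by rewrite /y; lra.
  have ym : y < Num.min p w by rewrite /y; lra.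
  have : `[p, r]%classic y.
    by apply: sub; rewrite /= in_itv/= uy (lt_le_trans ym)// ge_min lexx orbT.
  by rewrite /= in_itv/= => /andP[py _]; move: ym; rewrite lt_min ltNge py.
have mw : Num.max r u < w by rewrite gt_max h.
pose y := (Num.max r u + w) / 2.
have yw : y < w by rewrite /y; lra.
have my : Num.max r u < y by rewrite /y; lra.
have : `[p, r]%classic y.
  by apply: sub; rewrite /= in_itv/= yw andbT (le_lt_trans _ my)// le_max lexx orbT.
by rewrite /= in_itv/= => /andP[_ yr]; move: my; rewrite gt_max ltNge yr.
Qed.

Variables (q : R) (f : R -> R).
Hypotheses (q0 : 0 < q) (sf : singular q f).

Lemma convol1E x : convol (cst 1) f x = \int[mu]_(s in `]0, x[) f s.
Proof. by apply: eq_Rintegral => s _; rewrite mul1r. Qed.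

Lemma integrable_restrict_pos (x : R) : mu.-integrable `]0, x] (EFin \o (f \_ pos)).
Proof.
have := singular_integrable (x + 1) q0 sf => /(integrableS _ _ _) H.
have {}H : mu.-integrable `]0, x] (EFin \o f).
  by apply: H => //; apply: subset_itvl; rewrite bnd_simp ltrDl.
apply: eq_integrable H => // s; rewrite inE/= in_itv/= => /andP[s0 _].
by rewrite restrict_posE.
Qed.

(** The form to which the fundamental theorems of calculus apply: a half-open interval, and an
    integrand that is locally integrable on the whole line. *)
Lemma convol1_restrictE :
  convol (cst 1) f = fun x => \int[mu]_(s in `]0, x]) (f \_ pos) s.
Proof.
apply/funext => x; rewrite convol1E -Rintegral_itv_bndo_bndc; last first.
  apply: integrableS (integrable_restrict_pos x) => //.
  by apply: subset_itvl; rewrite bnd_simp.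
apply: eq_Rintegral => s; rewrite inE/= in_itv/= => /andP[s0 _].
by rewrite restrict_posE.
Qed.

Lemma locally_integrable_restrict_pos : locally_integrable setT (f \_ pos).
Proof.
split; [by apply: measurable_restrict_pos; case: sf|exact: openT|].
move=> K _ cK; have [M [Mr HM]] := compact_bounded cK.
pose N := `|M| + 1; have KN x : K x -> `|x| <= N.
  by move=> Kx; apply: HM Kx; rewrite (le_lt_trans (ler_norm _))// ltrDl.
have mK : measurable K by exact: compact_measurable.
have iN := integrable_restrict_pos N.
have E : (\int[mu]_(x in K) `|(f \_ pos) x|%:E =
   \int[mu]_(x in K `&` `]0%R, N]) `|(f \_ pos) x|%:E)%E.
  rewrite integral_mkcondr; apply: eq_integral => x /[!inE] Kx; rewrite [RHS]patchE.
  case: ifPn => //; rewrite notin_setE/= in_itv/= => /negP h.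
  rewrite restrict_pos0 ?normr0// leNgt; apply: contraNN h => ->/=.
  exact: le_trans (ler_norm _) (KN _ Kx).
rewrite E; have /integrableP[mf] := iN; apply: le_lt_trans.
apply: ge0_subset_integral => //.
- exact: measurableI.
- by apply/measurable_EFinP; apply: measurableT_comp => //; exact/measurable_EFinP.
Qed.

Lemma convol1_ae_derivable :
  {ae mu, forall x, 0 < x -> derivable (convol (cst 1) f) x 1 /\
    derive1 (convol (cst 1) f) x = f x}.
Proof.
have := FTC1 integrable_restrict_pos locally_integrable_restrict_pos.
rewrite -convol1_restrictE; apply: filterS; first exact: (ae_filter_ringOfSetsType mu).
move=> x h x0.
have bx : (BRight 0 < BRight x)%O by rewrite bnd_simp.
by have := h bx; rewrite restrict_posE.
Qed.

Lemma convol1_derivable x : 0 < x -> {for x, continuous f} ->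
  derivable (convol (cst 1) f) x 1 /\ derive1 (convol (cst 1) f) x = f x.
Proof.
move=> x0 cf; have x1 : x < x + 1 by rewrite ltrDl.
have cr' : (f \_ pos) y @[y --> x] --> f x.
  apply: cvg_trans cf; apply: near_eq_cvg; near=> y; rewrite restrict_posE//.
  by near: y; exact: lt_nbhsr.
rewrite -(restrict_posE f x0) in cr'.
have cr : {for x, continuous (f \_ pos)} by exact: cr'.
have bx : (BRight 0 < BRight x)%O by rewrite bnd_simp.
have := continuous_FTC1 x1 (integrable_restrict_pos (x + 1)) bx cr.
by rewrite -convol1_restrictE restrict_posE.
Unshelve. all: by end_near. Qed.

Lemma convol1B u w : 0 <= u -> u <= w ->
  convol (cst 1) f w - convol (cst 1) f u = \int[mu]_(s in `]u, w]) (f \_ pos) s.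
Proof.
move=> u0 uw; rewrite convol1_restrictE.
by rewrite (Rintegral_itvB (integrable_restrict_pos w)) ?bnd_simp.
Qed.

Lemma convol1_cvg0 : convol (cst 1) f x @[x --> 0^'+] --> 0.
Proof.
have [C C0 fC] := sf.2 1 ltr01.
have lim0 : C * (x `^ q / q) @[x --> 0^'+] --> 0.
  rewrite -[X in _ --> X](mulr0 C); apply: cvgMr.
  by rewrite -[X in _ --> X](mul0r q^-1); apply: cvgMl; exact: powR_cvg0.
apply/norm_cvg0P; apply: (squeeze_cvgr _ (cvg_cst 0) lim0).
near=> x; rewrite normr_ge0/=.
have x0 : 0 < x by near: x; exact: nbhs_right_gt.
have x1 : x <= 1 by near: x; apply: nbhs_right_le.
have ifx := singular_integrable x q0 sf.
rewrite convol1E (le_trans (le_normr_Rintegral _ _))//.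
apply: (@le_trans _ _ (\int[mu]_(s in `]0, x[) (C * s `^ (q - 1)))).
  apply: le_Rintegral => //; first exact: integrable_norm.
    by apply: integrableZl_EFin => //; exact: integrable_powR_itv.
  move=> s /=; rewrite in_itv/= => /andP[s0 sx]; apply: fC => //.
  by rewrite (le_trans (ltW sx)).
rewrite RintegralZl//; last exact: integrable_powR_itv.
rewrite ler_wpM2l// /Rintegral -lee_fin fineK ?integral_powR_itvoo_le//.
by apply: integrable_fin_num => //; exact: integrable_powR_itv.
Unshelve. all: by end_near. Qed.

(** The increments over disjoint intervals add up to at most the integral of |f| over their union,
    and this integral is small together with the measure of the union. *)
Lemma convol1_abs_continuous : locally_abs_continuous (convol (cst 1) f).
Proof.
move=> a b a0 ab e e0.
have ib : mu.-integrable setT (EFin \o (f \_ `]0, b])).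
  rewrite -restrict_EFin -integrable_mkcond//.
  apply: eq_integrable (integrable_restrict_pos b) => // s.
  by rewrite inE/= in_itv/= => /andP[s0 _]; rewrite restrict_posE.
have [d [d0 Hd]] := integral_normr_continuous ib e0.
exists d => // n u w uw tI sd.
have mI i : measurable (`]u i, w i[%classic : set R) by exact: measurable_itv.
pose A := \big[setU/set0]_(i < n) (`]u i, w i[%classic : set R).
have mA : measurable A by exact: bigsetU_measurable.
have muI i : mu `]u i, w i[%classic = (w i - u i)%:E.
  rewrite lebesgue_measure_itv/= lte_fin; case: ltP => // wu.
  by have [uw' _] := uw i; rewrite (le_anti (introT andP (conj wu uw'))) subrr.
have muA : (mu A < d%:E)%E.
  apply: (@le_lt_trans _ _ (\sum_(i < n) mu `]u i, w i[%classic)%E).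
    by rewrite /A measure_bigsetU_ord.
  by under eq_bigr do rewrite muI; rewrite sumEFin lte_fin.
apply: le_lt_trans (Hd A mA muA).
have iA : mu.-integrable A (EFin \o (Num.norm \o (f \_ `]0, b]))).
  by apply: integrable_norm; apply: integrableS ib.
have E : (\int[mu]_(x in A) `|(f \_ `]0, b]) x| =
    \sum_(i < n) \int[mu]_(x in `]u i, w i[) `|(f \_ `]0, b]) x|)%R.
  apply: EFin_inj; rewrite -sumEFin {1}/Rintegral fineK; last exact: integrable_fin_num.
  rewrite ge0_integral_bigsetU ?index_enum_uniq//.
  - apply: eq_bigr => i _; rewrite /Rintegral fineK//; apply: integrable_fin_num => //.
    by apply: integrable_norm; apply: integrableS ib.
  - exact: sub_trivIset tI.
  - exact: (measurable_int mu iA).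
rewrite E; apply: ler_sum => i _; have [uw' sub] := uw i.
move: uw'; rewrite le_eqVlt => /predU1P[->|uw'].
  by rewrite subrr normr0; apply: Rintegral_ge0.
have [au wb] := subitv_endpoints uw' sub.
have u0 : 0 < u i by exact: lt_le_trans au.
have iuw : mu.-integrable `]u i, w i] (EFin \o (f \_ pos)).
  apply: integrableS (integrable_restrict_pos b) => // s /=; rewrite !in_itv/=.
  by move=> /andP[us sw]; rewrite (lt_trans u0)//= (le_trans sw).
rewrite convol1B ?(ltW u0) ?(ltW uw')// (le_trans (le_normr_Rintegral _ _))//.
rewrite -Rintegral_itv_bndo_bndc; last first.
  have iuwo : mu.-integrable `]u i, w i[ (EFin \o (f \_ pos)).
    by apply: integrableS iuw => //; apply: subset_itvl; rewrite bnd_simp.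
  exact: (integrable_norm iuwo).
rewrite le_eqVlt; apply/orP; left; apply/eqP; apply: eq_Rintegral => s.
rewrite inE/= in_itv/= => /andP[us sw].
have s0 : 0 < s by exact: lt_trans us.
have sb : s <= b by apply: le_trans wb; exact: ltW.
by rewrite restrict_posE// patchE mem_set//= in_itv/= s0.
Qed.

End primitive.

(** * Absolutely continuous functions with vanishing derivative *)

Section zero_derivative.
Context {R : realType}.
Local Notation mu := (@lebesgue_measure R).

Lemma derive1_eq0_near (F : R -> R) (t e : R) :
  derivable F t 1 -> derive1 F t = 0 -> 0 < e ->
  exists2 d : R, 0 < d & forall y, `|y - t| < d -> `|F y - F t| <= e * `|y - t|.
Proof.
move=> dF F0 e0; rewrite derive1E in F0.
have : h^-1 *: (F (h *: 1 + t) - F t) @[h --> 0^'] --> 'D_1 F t by exact: dF.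
rewrite F0.
move=> /cvgrPdist_lt /(_ _ e0) /nbhs_ballP[d /= d0 H]; exists d => // y yd.
have [->|yt] := eqVneq y t; first by rewrite !subrr normr0 mulr0.
have yt0 : y - t != 0 by rewrite subr_eq0.
have := H (y - t); rewrite /ball/= sub0r normrN => /(_ yd yt0).
rewrite sub0r normrN /GRing.scale/= mulr1 subrK normrM normfV => h.
by rewrite mulrC -ler_pdivrMl ?normr_gt0// ltW.
Qed.

Variables (F : R -> R) (p r : R).
Hypotheses (pr : p < r) (acF : abs_continuous p r F).
Hypothesis F'0 : \forall x \ae mu, p < x -> x < r ->
  derivable F x 1 /\ derive1 F x = 0.

Section cover.
Variables (e : R) (U : set R).
Hypotheses (e0 : 0 < e) (oU : open U) (fU : (mu U < +oo)%E).
Hypothesis dF : forall x, p <= x -> x <= r -> ~ U x ->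
  derivable F x 1 /\ derive1 F x = 0.

(** The budget for the total length of the selected intervals: one adjoined at the right end and
    contained in [U] is paid for by the growth of [m]. *)
Let m x := fine (mu (U `&` `]p, x[)).

Let mI x : measurable (U `&` `]p, x[).
Proof. by apply: measurableI => //; exact: open_measurable. Qed.

Let fI x : mu (U `&` `]p, x[) \is a fin_num.
Proof.
rewrite ge0_fin_numE//; apply: le_lt_trans fU; apply: le_measure.
- by rewrite inE; exact: mI.
- by rewrite inE; exact: open_measurable.
- exact: subIsetl.
Qed.

Let m_le x y : x <= y -> m x <= m y.
Proof.
move=> xy; rewrite fine_le//; apply: le_measure; rewrite ?inE; [exact: mI|exact: mI|].
by apply: setIS; apply: subset_itvl; rewrite bnd_simp.
Qed.

Let m_add x z : p <= x -> x <= z -> `]x, z[ `<=` U -> m x + (z - x) <= m z.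
Proof.
move=> px; rewrite le_eqVlt => /predU1P[->|xz sU]; first by rewrite subrr addr0.
have muxz : mu `]x, z[%classic = (z - x)%:E.
  by rewrite lebesgue_measure_itv/= lte_fin xz.
rewrite -lee_fin EFinD -muxz /m !fineK//.
have E : mu ((U `&` `]p, x[) `|` `]x, z[) = (mu (U `&` `]p, x[) + mu `]x, z[%classic)%E.
  apply: measureU; [exact: mI|exact: measurable_itv|].
  apply/seteqP; split => y //=; rewrite !in_itv/= => -[[_ /andP[_ yx]] /andP[xy _]].
  by move: (lt_trans yx xy); rewrite ltxx.
rewrite -E; apply: le_measure; rewrite ?inE.
- by apply: measurableU; [exact: mI|exact: measurable_itv].
- exact: mI.
- move=> y [[Uy]|] /=; rewrite in_itv/= => /andP[h1 h2]; split.
  + by [].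
  + by rewrite in_itv/= h1 (lt_trans h2).
  + by apply: sU; rewrite /= in_itv/= h1.
  + by rewrite in_itv/= h2 (le_lt_trans px).
Qed.

(* Real induction: up to a good [x], [F] varies at rate at most [e], except on
   disjoint intervals contained in the open cover [U] of the exceptional set. *)
Let good x := exists s : seq (R * R),
  [/\ all (fun a => [&& p <= a.1, a.1 <= a.2 & a.2 <= x]) s,
      pairwise (fun a b => b.2 <= a.1) s,
      \sum_(a <- s) (a.2 - a.1) <= m x &
      `|F x - F p| <= e * (x - p) + \sum_(a <- s) `|F a.2 - F a.1|].

(** For t in [U] the interval [x, z] is added to the list. Otherwise the derivative vanishes at t,
    and crossing from x to z costs at most e (z - x). A vanishing derivative controls only the
    increments based at t, so x and z have to lie on the two sides of it. *)
Let good_step t : p <= t -> t <= r -> exists2 d : R, 0 < d &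
  forall x z, p <= x -> t - d < x -> x <= t -> t <= z -> z < t + d -> z <= r ->
    good x -> good z.
Proof.
move=> pt tr; have [Ut|nUt] := pselect (U t).
  have [d /= d0 Hd] := (nbhs_ballP _ _).1 (open_nbhs_nbhs (conj oU Ut)).
  exists d => // x z px dx xt tz zd zr [s [s1 s2 s3 s4]].
  have xz : x <= z by exact: le_trans tz.
  exists ((x, z) :: s); split => /=.
  - rewrite px xz lexx/=; apply: sub_all s1 => a /and3P[-> -> /=] ax.
    exact: le_trans xz.
  - by rewrite s2 andbT; apply: sub_all s1 => a /and3P[].
  - rewrite big_cons/= addrC; apply: le_trans (m_add px xz _); first by rewrite lerD2r.
    move=> y; rewrite /= in_itv/= => /andP[xy yz]; apply: Hd.
    by rewrite /ball/= ltr_norml; apply/andP; split; lra.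
  - rewrite big_cons/= (_ : F z - F p = (F z - F x) + (F x - F p)); last ring.
    rewrite (le_trans (ler_normD _ _))// addrCA lerD2l (le_trans s4)// lerD2r.
    by rewrite ler_pM2l// lerD2r.
have [dFt F0] := dF pt tr nUt.
have [d d0 Hd] := derive1_eq0_near dFt F0 e0.
exists d => // x z px dx xt tz zd zr [s [s1 s2 s3 s4]].
have xz : x <= z by exact: le_trans tz.
exists s; split => //.
- apply: sub_all s1 => a /and3P[-> -> /=] ax; exact: le_trans xz.
- by apply: le_trans s3 _; exact: m_le.
- have hx := Hd x; have hz := Hd z.
  rewrite ler0_norm ?subr_le0// in hx; rewrite ger0_norm ?subr_ge0// in hz.
  have {}hx : `|F x - F t| <= e * - (x - t) by apply: hx; lra.
  have {}hz : `|F z - F t| <= e * (z - t) by apply: hz; lra.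
  rewrite (_ : F z - F p = (F z - F t) + (F t - F x) + (F x - F p)); last ring.
  have -> : e * (z - p) = e * (z - t) + e * - (x - t) + e * (x - p) by ring.
  have n1 := ler_normD (F z - F t + (F t - F x)) (F x - F p).
  have n2 := ler_normD (F z - F t) (F t - F x).
  by rewrite distrC in hx; lra.
Qed.

Let good_end : good r.
Proof.
pose S := [set x | p <= x <= r /\ good x].
have Sp : S p.
  split; first by rewrite lexx ltW.
  exists [::]; split => //=; rewrite ?big_nil ?subrr ?mulr0 ?normr0 ?addr0//.
  exact: fine_ge0.
have uS : has_sup S.
  by split; [exists p|exists r => x [/andP[]]].
pose c := sup S.
have pc : p <= c by apply: ub_le_sup => //; case: uS.
have cr : c <= r by apply: ge_sup; [exists p|move=> x [/andP[]]].
have [d d0 Hd] := good_step pc cr.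
have [x Sx dx] := sup_adherent d0 uS; rewrite -/c in dx.
have [/andP[px xr] gx] := Sx.
have xc : x <= c by apply: ub_le_sup => //; case: uS.
(* This point is good and lies beyond the supremum [c], unless it equals [r]. *)
pose z := Num.min (c + d / 2) r.
have cz : c <= z by rewrite le_min cr andbT; lra.
have zr : z <= r by rewrite ge_min lexx orbT.
have gz : good z.
  by apply: (Hd x z) => //; rewrite gt_min; apply/orP; left; lra.
have zc : z <= c by apply: ub_le_sup; [case: uS|split => //; rewrite zr (le_trans pc)].
have : z = r by move: zc; rewrite /z minElt; case: ifPn => // _ ?; lra.
by move=> <-.
Qed.

Lemma cover_increment : exists s : seq (R * R),
  [/\ all (fun a => [&& p <= a.1, a.1 <= a.2 & a.2 <= r]) s,
      pairwise (fun a b => b.2 <= a.1) s,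
      \sum_(a <- s) (a.2 - a.1) <= fine (mu U) &
      `|F r - F p| <= e * (r - p) + \sum_(a <- s) `|F a.2 - F a.1|].
Proof.
have [s [s1 s2 s3 s4]] := good_end; exists s; split => //.
apply: (le_trans s3); rewrite fine_le// ?ge0_fin_numE//; apply: le_measure.
- by rewrite inE; exact: mI.
- by rewrite inE; exact: open_measurable.
- exact: subIsetl.
Qed.

End cover.

(** Absolute continuity for lists of intervals ordered from right to left, the form in which the
    real induction delivers them. *)
Lemma abs_continuous_seq (e : R) : 0 < e -> exists2 d : R, 0 < d &
  forall s : seq (R * R),
    all (fun a => [&& p <= a.1, a.1 <= a.2 & a.2 <= r]) s ->
    pairwise (fun a b => b.2 <= a.1) s ->
    \sum_(a <- s) (a.2 - a.1) < d ->
    \sum_(a <- s) `|F a.2 - F a.1| < e.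
Proof.
move=> e0; have [d d0 Hd] := acF e0; exists d => // s s1 s2 s3.
pose a (i : 'I_(size s)) := nth (p, p) s i.
have sumE (h : R * R -> R) : \sum_(a <- s) h a = \sum_(i < size s) h (a i).
  by rewrite (big_nth (p, p)) big_mkord.
rewrite sumE; apply: (Hd _ (fun i => (a i).1) (fun i => (a i).2)).
- move=> i; have /allP/(_ (a i)) := s1; rewrite mem_nth// => /(_ isT).
  move=> /and3P[pa aa ar]; split=> // x /=; rewrite !in_itv/= => /andP[ax xa].
  by rewrite (le_trans pa (ltW ax)) (le_trans (ltW xa)).
- apply/trivIsetP => i j _ _ ij.
  have H k l : (k < l)%N -> (k < size s)%N -> (l < size s)%N ->
      (nth (p, p) s l).2 <= (nth (p, p) s k).1.
    by move=> kl ks ls; have /(pairwiseP (p, p)) := s2; apply.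
  apply/seteqP; split => x //=; rewrite !in_itv/= => -[/andP[x1 x2] /andP[x3 x4]].
  have := ij; rewrite -(inj_eq val_inj)/= neq_ltn => /orP[] h.
    have := H _ _ h (ltn_ord _) (ltn_ord _); rewrite -/(a i) -/(a j).
    by move=> /(lt_le_trans x4)/(lt_trans x1); rewrite ltxx.
  have := H _ _ h (ltn_ord _) (ltn_ord _); rewrite -/(a i) -/(a j).
  by move=> /(lt_le_trans x2)/(lt_trans x3); rewrite ltxx.
- by rewrite -(sumE (fun a => a.2 - a.1)).
Qed.

(** The exceptional set is covered by an open [U] of measure below the [d] that absolute continuity
    assigns to [e]. The increment of [F] is then at most e (r - p) plus a sum below [e], and [e] is
    arbitrary. *)
Lemma abs_continuous_derive0 : F r = F p.
Proof.
suff H e : 0 < e -> `|F r - F p| <= e * (r - p + 1).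
  apply/eqP; rewrite -subr_eq0 -normr_le0 leNgt; apply/negP => h.
  have k0 : 0 < r - p + 1 by rewrite addr_gt0 ?subr_gt0.
  have := H (`|F r - F p| / (2 * (r - p + 1))).
  rewrite divr_gt0 ?mulr_gt0// => /(_ isT).
  rewrite (_ : _ / _ * _ = `|F r - F p| / 2); last by field; rewrite gt_eqF.
  by lra.
move=> e0; have [d d0 Hd] := abs_continuous_seq e0.
have [N [mN N0 NF]] := F'0.
(* The derivative is controlled only inside (p, r), while the covering argument runs over the closed
   interval; the endpoints join the exceptional set. *)
pose D := N `|` [set p; r].
have mpr : measurable [set p; r] by apply: measurableU; exact: measurable_set1.
have mD : measurable D by apply: measurableU.
have D0 : mu D = 0%E.
  apply: null_set_setU => //; apply: null_set_setU => //; exact: lebesgue_measure_set1.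
have Doo : (mu D < +oo)%E by rewrite D0.
have [U [oU DU UD]] := lebesgue_regularity_outer mD Doo d0.
have mU : measurable U by exact: open_measurable.
have muU : (mu U < d%:E)%E.
  apply: le_lt_trans UD; rewrite -(setDUK DU).
  rewrite -[leRHS]add0e -[in leRHS]D0 setDUK//.
  rewrite -{1}(setDUK DU); apply: measureU2 => //; exact: measurableD.
have fU : (mu U < +oo)%E by exact: lt_trans muU (ltry _).
have dFU x : p <= x -> x <= r -> ~ U x -> derivable F x 1 /\ derive1 F x = 0.
  move=> px xr nU; apply: contrapT => nd; apply: nU; apply: DU.
  have [xp|xp] := eqVneq x p; first by right; left.
  have [xr'|xr'] := eqVneq x r; first by right; right.
  left; apply: NF => /= h; apply: nd; apply: h; rewrite lt_neqAle.
    by rewrite eq_sym xp.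
  by rewrite xr'.
have [s [s1 s2 s3 s4]] := cover_increment e0 oU fU dFU.
rewrite mulrDr mulr1 (le_trans s4)// lerD2l ltW//; apply: Hd => //.
by apply: (le_lt_trans s3); rewrite -lte_fin fineK// ge0_fin_numE.
Qed.

End zero_derivative.

(** * Continuity of convolutions *)

Section continuity.
Context {R : realType}.
Local Notation mu := (@lebesgue_measure R).
Local Notation pos := (`]0, +oo[%classic : set R).

(* Damping [f] on [(0, d)] makes it bounded, so that dominated convergence gives
   the continuity of its convolutions; the error is of order [d `^ q]. *)
Definition truncation (d : R) (f : R -> R) (x : R) : R :=
  f (Num.max x d) * Num.max 0 (Num.min 1 (x / d)).

Lemma truncation_ge d f x : 0 < d -> d <= x -> truncation d f x = f x.
Proof.
move=> d0 dx; rewrite /truncation (max_idPl dx) (min_idPl _) ?(max_idPr _)// ?mulr1//.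
by rewrite ler_pdivlMr// mul1r.
Qed.

Lemma truncation_le0 d f x : 0 < d -> x <= 0 -> truncation d f x = 0.
Proof.
move=> d0 x0; rewrite /truncation (_ : Num.max 0 _ = 0) ?mulr0//.
by apply/max_idPl; rewrite ge_min; apply/orP; right; rewrite pmulr_lle0// invr_gt0.
Qed.

Lemma continuous_truncation d f : 0 < d -> {in pos, continuous f} ->
  continuous (truncation d f).
Proof.
move=> d0 cf x; apply: cvgM.
  have cm : {for x, continuous (fun y : R => Num.max y d)}.
    by apply: (@continuous_max _ _ id (cst d)); [exact: cvg_id|exact: cvg_cst].
  apply: (continuous_comp cm); apply: cf.
  by rewrite inE/= in_itv/= andbT lt_max d0 orbT.
apply: (@continuous_max _ _ (cst 0) (fun y : R => Num.min 1 (y / d))); first exact: cvg_cst.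
apply: (@continuous_min _ _ (cst 1) (fun y : R => y / d)); first exact: cvg_cst.
exact: mulrr_continuous.
Qed.

Lemma truncation_bound (q C d T : R) f x : q <= 1 -> 0 < d -> d <= T -> 0 <= C ->
  (forall y, 0 < y -> y <= T -> `|f y| <= C * y `^ (q - 1)) ->
  x <= T -> `|truncation d f x| <= C * d `^ (q - 1).
Proof.
move=> q1 d0 dT C0 fC xT; rewrite /truncation normrM.
have m1 : `|Num.max 0 (Num.min 1 (x / d))| <= 1.
  by rewrite ger0_norm ?le_max ?lexx// ge_max ler01 ge_min lexx.
rewrite (@le_trans _ _ (`|f (Num.max x d)|))// ?ler_piMr//.
rewrite (le_trans (fC _ _ _))//; first by rewrite lt_max d0 orbT.
  by rewrite ge_max xT.
rewrite ler_wpM2l//; apply: le_powR_neg => //; by rewrite le_max lexx orbT.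
Qed.

Lemma continuous_convol (q : R) f h : 0 < q -> q <= 1 ->
  singular q f -> singular q h -> {in pos, continuous f} ->
  {in pos, continuous (convol f h)}.
Proof.
move=> q0 q1 sf sh cf x0; rewrite inE/= in_itv/= andbT => x00.
pose T := 2 * x0; have T0 : 0 < T by rewrite mulr_gt0.
have [C C0 fC] := sf.2 T T0; have [D D0 hD] := sh.2 T T0.
have ihT := singular_integrable T q0 sh.
(* For x > x0 / 2 and d <= x0 / 4 the damping acts only where x - s < d, hence s > x0 / 4. There |h|
   is at most D (x0 / 4)^(q - 1), and [f] differs from its truncation by at most 2 C (x - s)^(q -
   1). *)
pose K := 2 * C * (D * (x0 / 4) `^ (q - 1)).
have K0 : 0 <= K by rewrite !mulr_ge0 ?powR_ge0.
(* The truncation vanishes at nonpositive arguments, so the domain can be the fixed interval (0, T)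
   for all x < T, as continuity under the integral requires. *)
pose g d x := \int[mu]_(s in `]0, T[) (truncation d f (x - s) * h s).
have mtr d x D' : 0 < d -> measurable_fun D' (fun s : R => truncation d f (x - s)).
  move=> d0; apply: measurable_funTS; apply: measurableT_comp; last exact: measurable_refl.
  by apply: continuous_measurable_fun; exact: continuous_truncation.
have itr d x : 0 < d -> d <= T -> x < T ->
    mu.-integrable `]0, T[ (EFin \o (fun s => truncation d f (x - s) * h s)).
  move=> d0 dT xT.
  have ih := integrableZl_EFin (C * d `^ (q - 1)) (measurable_itv _) (integrable_norm ihT).
  apply: (le_integrable _ _ _ ih) => //.
    apply/measurable_EFinP; apply: measurable_funM; first exact: mtr.
    by apply: measurable_pos_itv; case: sh.
  move=> s /=; rewrite in_itv/= => /andP[s0 sT]; rewrite lee_fin [leLHS]normrM.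
  rewrite [leRHS]ger0_norm ?mulr_ge0 ?powR_ge0// ler_wpM2r//.
  apply: (truncation_bound q1 d0 dT C0 fC); lra.
have cg d : 0 < d -> d <= T -> {for x0, continuous (g d)}.
  move=> d0 dT.
  have x0T : x0 \in (`]0, T[%classic : set R) by rewrite inE/= in_itv/= x00 /T; lra.
  apply: (@continuity_under_integral _ _ _ mu (fun x s => truncation d f (x - s) * h s)
    `]0, T[ _ 0 T _ _ (fun s => C * d `^ (q - 1) * `|h s|)) x0T => //.
  - by move=> x /=; rewrite in_itv/= => /andP[_ xT]; exact: itr.
  - apply: aeW => s /= _ x _; apply: cvgMl.
    have cs : y - s @[y --> x] --> x - s by apply: cvgB; [exact: cvg_id|exact: cvg_cst].
    by apply: (cvg_comp _ _ cs); exact: continuous_truncation.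
  - by apply: integrableZl_EFin => //; exact: integrable_norm.
  - move=> x /=; rewrite in_itv/= => /andP[_ xT]; apply: aeW => s /=.
    rewrite in_itv/= => /andP[s0 _]; rewrite normrM ler_wpM2r//.
    apply: (truncation_bound q1 d0 dT C0 fC); lra.
have gap d x : 0 < d -> d <= x0 / 4 -> x0 / 2 < x -> x < T ->
    `|convol f h x - g d x| <= K * (d `^ q / q).
  move=> d0 dx xl xT.
  have x0' : 0 < x by lra.
  have dT : d <= T by rewrite /T; lra.
  have igT := itr d x d0 dT xT.
  have gE : g d x = \int[mu]_(s in `]0, x[) (truncation d f (x - s) * h s).
    rewrite /g Rintegral_mkcond [RHS]Rintegral_mkcond; apply: eq_Rintegral => s _.
    rewrite !patchE; have [sx|sx] := ltP s x; last first.
      rewrite truncation_le0 ?subr_le0// mul0r; by do 2 case: ifP.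
    by rewrite !mem_setE !in_itv/= sx (lt_trans sx xT).
  have i1 := convol_integrable x q0 q1 sf sh.
  have i2 : mu.-integrable `]0, x[ (EFin \o (fun s => truncation d f (x - s) * h s)).
    by apply: integrableS igT => //; apply: subset_itvl; rewrite bnd_simp ltW.
  pose phi := (fun y : R => y `^ (q - 1)) \_ `]0, d[.
  have iphi : mu.-integrable `]0, x[ (EFin \o phi).
    rewrite /phi -restrict_EFin; apply/integrable_restrict => //.
    by apply: integrableS (integrable_powR_itv x q0) => //; exact: measurableI.
  have iphir := integrable_itv_refl iphi.
  rewrite gE /convol -RintegralB//.
  have iB := integrableB_EFin (measurable_itv _) i1 i2.
  rewrite (le_trans (le_normr_Rintegral _ _))//.
  apply: (@le_trans _ _ (\int[mu]_(s in `]0, x[) (K * phi (x - s)))).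
    apply: le_Rintegral => //; first exact: (integrable_norm iB).
      exact: (integrableZl_EFin K _ iphir).
    move=> s /=; rewrite in_itv/= => /andP[s0 sx].
    rewrite -mulrBl normrM /phi patchE; case: ifPn => [|].
      rewrite inE/= in_itv/= => /andP[xs0 xsd].
      rewrite /K mulrAC; apply: ler_pM => //.
        rewrite (le_trans (ler_normB _ _))// mulrDl mul1r mulrDl lerD//.
          by apply: fC => //; lra.
        apply: (le_trans (truncation_bound q1 d0 dT C0 fC _)); first lra.
        by rewrite ler_wpM2l// le_powR_neg// ltW.
      apply: (le_trans (hD s s0 _)); first lra.
      by rewrite ler_wpM2l// le_powR_neg//; lra.
    rewrite notin_setE/= in_itv/= subr_gt0 sx/= => /negP; rewrite -leNgt => ds.
    by rewrite truncation_ge// subrr normr0 mul0r mulr0.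
  rewrite RintegralZl// ler_wpM2l//.
  rewrite /Rintegral (integral_itv_refl (f := EFin \o phi)); last first.
    exact: (measurable_int mu iphi).
  rewrite -lee_fin fineK; last exact: integrable_fin_num.
  apply: le_trans (integral_powR_itvoo_le q0 d0).
  rewrite /phi -restrict_EFin -integral_mkcondr; apply: ge0_subset_integral => //.
  - exact: measurableI.
  - exact: measurable_powR_itv.
  - by move=> y _; rewrite lee_fin powR_ge0.
have lim0 : K * (d `^ q / q) @[d --> 0^'+] --> 0.
  rewrite -[X in _ --> X](mulr0 K); apply: cvgMr.
  by rewrite -[X in _ --> X](mul0r q^-1); apply: cvgMl; exact: powR_cvg0.
apply/cvgrPdist_lt => e e0; have e30 : 0 < e / 3 by rewrite divr_gt0.
have [d [d0 dx dK]] : exists d : R, [/\ 0 < d, d <= x0 / 4 & K * (d `^ q / q) < e / 3].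
  near (0 : R)^'+ => d; exists d; split.
  - by near: d; exact: nbhs_right_gt.
  - by near: d; apply: nbhs_right_le; rewrite divr_gt0.
  - by near: d; exact: (cvgr_lt 0).
have dT : d <= T by rewrite /T; lra.
have /cvgrPdist_lt/(_ _ e30) cgd := cg d d0 dT.
near=> x.
have gx0 := gap d x0 d0 dx _ _; have gx := gap d x d0 dx _ _.
have {}gx0 : `|convol f h x0 - g d x0| <= K * (d `^ q / q) by apply: gx0; rewrite /T; lra.
have {}gx : `|convol f h x - g d x| <= K * (d `^ q / q).
  apply: gx; near: x; [apply: lt_nbhsr|apply: lt_nbhsl]; rewrite /T; lra.
have ggx : `|g d x0 - g d x| < e / 3 by near: x.
rewrite (_ : _ - _ =
  (convol f h x0 - g d x0) + (g d x0 - g d x) - (convol f h x - g d x)); last ring.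
have n1 := ler_normB ((convol f h x0 - g d x0) + (g d x0 - g d x)) (convol f h x - g d x).
have n2 := ler_normD (convol f h x0 - g d x0) (g d x0 - g d x).
lra.
Unshelve. all: by end_near. Qed.

End continuity.

(** * The resolvent and the scale function *)

Section resolvent.
Context {R : realType}.
Local Notation mu := (@lebesgue_measure R).
Local Notation pos := (`]0, +oo[%classic : set R).

(** A weighted form of [mul_powR_le]. With exp(l x) taken out, the damping exp(- l (x - s)) is left;
    for s <= x / 2 it is at most exp(- l s), so it can always accompany the power that stays under
    the integral. That integral is then at most Gamma(a) l^(- a), small for large l. *)
Lemma mul_powR_expR_le (a l x s : R) : a <= 1 -> 0 <= l -> 0 < s -> s < x ->
  (x - s) `^ (a - 1) * s `^ (a - 1) * expR (l * s) <=
  (x / 2) `^ (a - 1) * expR (l * x) *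
  (expR (- l * (x - s)) * (x - s) `^ (a - 1) + expR (- l * s) * s `^ (a - 1)).
Proof.
move=> a1 l0 s0 sx.
have -> : expR (l * s) = expR (l * x) * expR (- l * (x - s)).
  by rewrite -expRD; congr expR; ring.
set P := expR (l * x); set E1 := expR (- l * (x - s)); set E2 := expR (- l * s).
have P0 : 0 < P := expR_gt0 _; have E10 : 0 < E1 := expR_gt0 _.
have E20 : 0 < E2 := expR_gt0 _.
set u := (x - s) `^ (a - 1); set v := s `^ (a - 1).
have u0 : 0 <= u := powR_ge0 _ _; have v0 : 0 <= v := powR_ge0 _ _.
set h := (x / 2) `^ (a - 1); have h0 : 0 <= h := powR_ge0 _ _.
rewrite [leLHS](_ : _ = P * (E1 * u * v)); last ring.
rewrite [leRHS](_ : _ = P * (h * (E1 * u + E2 * v))); last ring.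
rewrite ler_pM2l//; have [sx2|sx2] := leP s (x / 2).
  have uh : u <= h by apply: le_powR_neg => //; lra.
  have E12 : E1 <= E2.
    by rewrite ler_expR !mulNr lerN2 ler_wpM2l//; lra.
  apply: (@le_trans _ _ (h * (E2 * v))); last first.
    by rewrite ler_wpM2l// lerDr mulr_ge0// ltW.
  rewrite mulrAC (mulrC h) ler_pM ?mulr_ge0 ?(ltW E10)//.
  by rewrite ler_wpM2r.
have vh : v <= h by apply: le_powR_neg => //; lra.
apply: (@le_trans _ _ (h * (E1 * u))).
  by rewrite [leRHS]mulrC ler_wpM2l// mulr_ge0// ltW.
by rewrite ler_wpM2l// lerDl mulr_ge0// ltW.
Qed.

Variables a b c : R.
Hypotheses (a0 : 0 < a) (a1 : a < 1) (b0 : 0 <= b) (c0 : 0 < c).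

Let k := frac_kernel a c.
Let kappa := (c * Gamma a)^-1.
(** In [frac_kernel_convol_bound] the power of 1/2 comes from x / 2, the factor 2 from the two terms
    of [mul_powR_expR_le], and the Gamma(a) of the integral cancels against [kappa]. *)
Let A := 2^-1 `^ (a - 1) * 2 / c.

Let Ga : 0 < Gamma a. Proof. exact: Gamma_gt0 (ltW a1). Qed.
Let kappa0 : 0 < kappa. Proof. by rewrite invr_gt0 mulr_gt0. Qed.
Let A0 : 0 < A. Proof. by rewrite divr_gt0// mulr_gt0// powR_gt0. Qed.
Let sk : singular a k. Proof. exact: singular_frac_kernel. Qed.

Lemma frac_kernel_ge0 x : 0 <= k x.
Proof. by rewrite mulr_ge0 ?powR_ge0// ltW. Qed.

Lemma singular_exp (D l : R) : 0 <= l ->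
  singular a (fun s => D * (s `^ (a - 1) * expR (l * s))).
Proof.
move=> l0; split.
  apply: measurable_funM => //; apply: measurable_funM; first exact: measurable_powRD.
  by have := @measurable_expRD R pos (- l); rewrite opprK.
move=> T T0; exists (`|D| * expR (l * T)); first by rewrite mulr_ge0 ?expR_ge0.
move=> x x0 xT; rewrite normrM (ger0_norm (mulr_ge0 (powR_ge0 _ _) (expR_ge0 _))).
rewrite -mulrA ler_wpM2l// mulrC ler_wpM2r ?powR_ge0// ler_expR ler_wpM2l//.
Qed.

Lemma frac_kernel_convol_bound (l D x : R) (f : R -> R) : 0 < l -> 0 <= D ->
  measurable_fun pos f ->
  (forall s, 0 < s -> `|f s| <= D * (s `^ (a - 1) * expR (l * s))) -> 0 < x ->
  `|convol k f x| <= D * (A / l `^ a) * (x `^ (a - 1) * expR (l * x)).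
Proof.
move=> l0 D0 mf fD x0.
have sf : singular a f.
  split=> // T T0; have [C C0 H] := (singular_exp D (ltW l0)).2 T T0.
  exists C => // y y0 yT; apply: le_trans (H y y0 yT).
  by rewrite (le_trans (fD y y0))// ler_norm.
have ikf := convol_integrable x a0 (ltW a1) sk sf.
pose phi := fun y => expR (- l * y) * (1 * y `^ (a - 1)).
have [iL L] := laplace_powR a0 (ltW a1) 1 l0.
have iphi : mu.-integrable `]0, x[ (EFin \o phi).
  by apply: integrableS iL => //; exact: subitv_pos.
have iphir := integrable_itv_refl iphi.
have phi_le : \int[mu]_(s in `]0, x[) phi s <= Gamma a * l `^ (- a).
  rewrite -[leRHS]mul1r -L /laplace /Rintegral fine_le//; try exact: integrable_fin_num.
  apply: ge0_subset_integral => //.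
  - exact: (measurable_int mu iL).
  - move=> y _; rewrite lee_fin.
    exact: mulr_ge0 (expR_ge0 _) (mulr_ge0 ler01 (powR_ge0 _ _)).
  - exact: subitv_pos.
pose B := kappa * D * ((x / 2) `^ (a - 1) * expR (l * x)).
have B0 : 0 <= B by rewrite !mulr_ge0 ?powR_ge0 ?expR_ge0// ltW.
have isum := integrableD_EFin (measurable_itv _) iphir iphi.
rewrite (le_trans (le_normr_Rintegral _ _))//.
apply: (@le_trans _ _ (\int[mu]_(s in `]0, x[) (B * (phi (x - s) + phi s)))).
  apply: le_Rintegral => //; first exact: (integrable_norm ikf).
    exact: integrableZl_EFin.
  move=> s /=; rewrite in_itv/= => /andP[s0 sx].
  rewrite normrM (ger0_norm (frac_kernel_ge0 _)) /k /frac_kernel -/kappa.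
  rewrite (le_trans (ler_wpM2l _ (fD s s0)))// ?mulr_ge0 ?powR_ge0 ?(ltW kappa0)//.
  rewrite /B /phi !mul1r.
  rewrite [leLHS](_ : _ =
    kappa * D * ((x - s) `^ (a - 1) * s `^ (a - 1) * expR (l * s))); last ring.
  rewrite -[leRHS]mulrA ler_wpM2l ?mulr_ge0 ?(ltW kappa0)//.
  by apply: mul_powR_expR_le => //; exact: ltW.
rewrite RintegralZl// RintegralD//.
have -> : \int[mu]_(s in `]0, x[) phi (x - s) = \int[mu]_(s in `]0, x[) phi s.
  rewrite /Rintegral (integral_itv_refl (f := EFin \o phi))//.
  exact: (measurable_int mu iphi).
apply: (@le_trans _ _ (B * (Gamma a * l `^ (- a) + Gamma a * l `^ (- a)))).
  by rewrite ler_wpM2l// lerD.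
rewrite le_eqVlt; apply/orP; left; apply/eqP.
rewrite /B /kappa /A powRM ?(ltW x0)// ?invr_ge0// powRN.
by field; rewrite !gt_eqF// powR_gt0.
Qed.

Fixpoint resolvent_iter (n : nat) : R -> R :=
  if n is m.+1 then fun x => k x - b * convol k (resolvent_iter m) x else cst 0.

Let s := resolvent_iter.

Let ss n : singular a (s n).
Proof.
elim: n => [|n IH] /=.
  by apply: eq_singular (singular_powR a 0) => x _; rewrite mul0r.
by apply: singularB => //; apply: singularZ; exact: singular_convol (ltW a1) sk IH.
Qed.

(* For the weight [x `^ (a - 1) * expR (l * x)] with this [l], the map
   [f |-> b (k * f)] is a contraction of ratio 1/2. *)
Definition resolvent_rate : R := (2 * (b * A) + 1) `^ a^-1.
Let l := resolvent_rate.

Let bA0 : 0 <= b * A. Proof. by rewrite mulr_ge0// ltW. Qed.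

Lemma resolvent_rate_gt0 : 0 < l.
Proof. by rewrite powR_gt0// ltr_wpDl// mulr_ge0. Qed.

Let l0 := resolvent_rate_gt0.

(** Here l^a = 2 b A + 1; the summand 1 keeps [l] positive also when b = 0. *)
Let contract : b * (A / l `^ a) <= 2^-1.
Proof.
rewrite /l /resolvent_rate -powRrM mulVf ?(gt_eqF a0)// powRr1; last first.
  by rewrite addr_ge0// mulr_ge0.
rewrite mulrA ler_pdivrMr; last by rewrite ltr_wpDl// mulr_ge0.
lra.
Qed.

Let wt x : R := x `^ (a - 1) * expR (l * x).
Let wt0 x : 0 <= wt x. Proof. by rewrite mulr_ge0 ?powR_ge0 ?expR_ge0. Qed.

Let k_le x : 0 < x -> `|k x| <= kappa * wt x.
Proof.
move=> x0; rewrite ger0_norm ?frac_kernel_ge0// ler_wpM2l ?(ltW kappa0)//.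
by rewrite ler_peMr ?powR_ge0// -expR0 ler_expR mulr_ge0// ltW.
Qed.

Let step_bound D (f : R -> R) x : 0 <= D -> measurable_fun pos f ->
  (forall s, 0 < s -> `|f s| <= D * wt s) -> 0 < x ->
  `|b * convol k f x| <= D / 2 * wt x.
Proof.
move=> D0 mf fD x0; rewrite normrM (ger0_norm b0).
rewrite (le_trans (ler_wpM2l b0 (frac_kernel_convol_bound l0 D0 mf fD x0)))//.
have -> : b * (D * (A / l `^ a) * (x `^ (a - 1) * expR (l * x))) =
    D * (b * (A / l `^ a)) * wt x by rewrite /wt; ring.
by apply: ler_wpM2r => //; apply: ler_wpM2l.
Qed.

(** The constant 2 [kappa] is the fixed point of D |-> kappa + D / 2, so the bound reproduces itself
    along the iteration. Being uniform in n, it also supplies the majorant for dominated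
    convergence. *)
Let s_bound n x : 0 < x -> `|s n x| <= 2 * kappa * wt x.
Proof.
have K0 : 0 <= 2 * kappa by apply: mulr_ge0 => //; exact: ltW.
elim: n x => [|n IH] x x0 /=; first by rewrite normr0; exact: mulr_ge0.
have := step_bound K0 (ss n).1 IH x0; have := k_le x0.
rewrite (_ : 2 * kappa / 2 = kappa); last by field.
move=> h1 h2; apply: (le_trans (ler_normB _ _)); apply: (le_trans (lerD h1 h2)).
by rewrite le_eqVlt; apply/orP; left; apply/eqP; ring.
Qed.

Let d n x := s n.+1 x - s n x.

Let d_bound n x : 0 < x -> `|d n x| <= (kappa * wt x) * (2^-1) ^+ n.
Proof.
elim: n x => [|n IH] x x0.
  rewrite /d expr0 mulr1 (_ : _ - _ = k x); first exact: k_le.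
  rewrite /= (_ : convol k (cst 0) x = 0) ?mulr0 ?subr0//.
  rewrite /convol; under eq_Rintegral do rewrite mulr0.
  by rewrite Rintegral_cst// mul0r.
have -> : d n.+1 x = - (b * convol k (d n) x).
  have -> : convol k (d n) x = convol k (s n.+1) x - convol k (s n) x.
    have := convolDr a0 (ltW a1) x sk (ss n.+1) (singularZ (-1) (ss n)).
    rewrite (convolZr a0 (ltW a1) (-1) x sk (ss n)) mulN1r => <-.
    by apply: eq_convol => // y _ _; rewrite mulN1r.
  by rewrite /d /= -/s; ring.
rewrite normrN exprS.
have K0 : 0 <= kappa * (2^-1) ^+ n.
  by apply: mulr_ge0; [exact: ltW|apply: exprn_ge0; rewrite invr_ge0].
have md : measurable_fun pos (d n) by apply: measurable_funB; [case: (ss n.+1)|case: (ss n)].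
apply: le_trans (step_bound K0 md _ x0) _.
  by move=> y y0; apply: le_trans (IH y y0) _; rewrite mulrAC.
by set y := _ ^+ n; rewrite le_eqVlt; apply/orP; left; apply/eqP; field.
Qed.

Let s_series n x : s n x = series (fun i => d i x) n.
Proof.
elim: n => [|n IH]; first by rewrite seriesEnat/= big_geq.
by rewrite seriesSr -IH /d addrCA subrr addr0.
Qed.

Let s_cvg x : 0 < x -> cvg (s n x @[n --> \oo]).
Proof.
move=> x0; have -> : (fun n => s n x) = series (fun i => d i x).
  by apply/funext => n; exact: s_series.
apply: normed_cvg; apply: (@series_le_cvg _ _ (geometric (kappa * wt x) 2^-1)).
- by move=> n; exact: normr_ge0.
- move=> n; rewrite /geometric/=; apply: mulr_ge0; last by apply: exprn_ge0; rewrite invr_ge0.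
  by apply: mulr_ge0 => //; exact: ltW.
- by move=> n; exact: d_bound.
- by apply: is_cvg_geometric_series; rewrite ger0_norm ?invr_ge0// invf_lt1// ltr1n.
Qed.

Definition resolvent (x : R) : R := lim (s n x @[n --> \oo]).
Local Notation w := resolvent.

Lemma resolvent_bound x : 0 < x -> `|w x| <= 2 * kappa * wt x.
Proof.
move=> x0; have h : `|s n x| @[n --> \oo] --> `|w x| by apply: cvg_norm; exact: s_cvg.
by apply: (cvgr_to_le h); apply: nearW => n; exact: s_bound.
Qed.

Lemma singular_resolvent : singular a w.
Proof.
have mw : measurable_fun pos w.
  apply: (measurable_fun_cvg (h := s)); first by move=> n; case: (ss n).
  by move=> x /=; rewrite in_itv/= andbT; exact: s_cvg.
split=> // T T0; have [C C0 H] := (singular_exp (2 * kappa) (ltW l0)).2 T T0.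
exists C => // y y0 yT; apply: le_trans (H y y0 yT).
by rewrite (le_trans (resolvent_bound y0))// ler_norm.
Qed.

Let sw := singular_resolvent.

(** Passage to the limit in the Picard recursion, by dominated convergence under the uniform
    weighted bound on the iterates. *)
Lemma resolventE x : 0 < x -> w x = k x - b * convol k w x.
Proof.
move=> x0; have h : convol k (s n) x @[n --> \oo] --> convol k w x.
  have ig := convol_integrable x a0 (ltW a1) sk (singular_exp (2 * kappa) (ltW l0)).
  rewrite /convol /Rintegral; apply: fine_cvg.
  rewrite fineK; last first.
    by apply: integrable_fin_num => //; exact: convol_integrable a0 (ltW a1) sk sw.
  apply: (@dominated_cvg _ _ _ mu _ _ (fun n y => (k (x - y) * s n y)%:E) _
    (fun y => (k (x - y) * (2 * kappa * (y `^ (a - 1) * expR (l * y))))%:E)) => //=.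
  - by move=> n; exact: (measurable_int mu (convol_integrable x a0 (ltW a1) sk (ss n))).
  - move=> y /=; rewrite in_itv/= => /andP[y0 yx].
    apply/fine_cvgP; split; first exact: nearW.
    have h : k (x - y) * s n y @[n --> \oo] --> k (x - y) * w y.
      by apply: cvgMr; exact: s_cvg.
    exact: h.
  - move=> n y /=; rewrite in_itv/= => /andP[y0 yx].
    rewrite lee_fin normrM (ger0_norm (frac_kernel_ge0 _)) ler_wpM2l ?frac_kernel_ge0//.
    exact: s_bound.
have h1 : s n.+1 x @[n --> \oo] --> k x - b * convol k w x.
  by rewrite /=; apply: cvgB; [exact: cvg_cst|apply: cvgMr].
have h2 : s n.+1 x @[n --> \oo] --> w x.
  by rewrite (cvg_shiftS (fun n => s n x)); exact: s_cvg.
exact: (cvg_unique _ h2 h1).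
Qed.

(** Continuity is read off from the equation [resolventE]: both [k] and its convolution with the
    merely measurable [w] are continuous on (0, oo). *)
Lemma continuous_resolvent : {in pos, continuous w}.
Proof.
have ck : {in pos, continuous k}.
  move=> x; rewrite inE/= in_itv/= andbT => x0; apply: cvgMr.
  have cp : {for x, continuous (fun y : R => y `^ (a - 1))}.
    apply: differentiable_continuous; apply/derivable1_diffP.
    by apply: derivable_powR; rewrite in_itv/= x0.
  exact: cp.
move=> x xp; have x0 : 0 < x by move: xp; rewrite inE/= in_itv/= andbT.
have ckw := continuous_convol a0 (ltW a1) sk sw ck xp.
have h : k y - b * convol k w y @[y --> x] --> w x.
  by rewrite (resolventE x0); apply: cvgB; [exact: ck|apply: cvgMr].
apply: cvg_trans h; apply: near_eq_cvg; near=> y; rewrite resolventE//.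
by near: y; exact: lt_nbhsr.
Unshelve. all: by end_near. Qed.

(** For r > l the factor exp(- r x) outweighs the bound on [w]. The equation of [resolventE] then
    becomes a linear equation for the transform, solvable because b + c r^a > 0. *)
Lemma laplace_resolvent r : l < r -> laplace_integrable r w /\
  laplace r w = (b + c * r `^ a)^-1.
Proof.
move=> lr; have r0 : 0 < r by exact: lt_trans lr.
have iw : laplace_integrable r w.
  have rl : 0 < r - l by rewrite subr_gt0.
  have [iL _] := laplace_powR a0 (ltW a1) (2 * kappa) rl.
  apply: (le_integrable _ _ _ iL) => //.
    apply/measurable_EFinP; apply: measurable_funM; last by case: sw.
    exact: measurable_expRD.
  move=> x /=; rewrite in_itv/= andbT => x0; rewrite lee_fin [leLHS]normrM.
  have K0 : 0 <= 2 * kappa by apply: mulr_ge0 => //; exact: ltW.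
  rewrite [leRHS]ger0_norm; last exact: mulr_ge0 (expR_ge0 _) (mulr_ge0 K0 (powR_ge0 _ _)).
  rewrite (ger0_norm (expR_ge0 _)).
  rewrite (le_trans (ler_wpM2l (expR_ge0 _) (resolvent_bound x0)))// /wt.
  rewrite (_ : - (r - l) * x = - r * x + l * x); last ring.
  by rewrite expRD le_eqVlt; apply/orP; left; apply/eqP; ring.
split=> //.
have [ik lk] := laplace_frac_kernel a0 a1 c0 r0.
have [ikw lkw] := laplace_convol a0 (ltW a1) sk sw ik iw.
have ra := powR_gt0 a r0.
have E : laplace r w = laplace r k - b * laplace r (convol k w).
  rewrite /laplace -RintegralZl// -RintegralB//; last exact: integrableZl_EFin.
  apply: eq_Rintegral => x; rewrite inE/= in_itv/= andbT => x0.
  by rewrite {1}resolventE//; ring.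
rewrite lkw lk in E.
have den : 0 < b + c * r `^ a by rewrite ltr_wpDl// mulr_gt0.
have {}E : laplace r w * (b + c * r `^ a) = 1.
  have cr : c * r `^ a != 0 by rewrite gt_eqF// mulr_gt0.
  have : laplace r w * (c * r `^ a) = 1 - b * laplace r w.
    by rewrite {1}E; field; rewrite gt_eqF//= gt_eqF.
  by move=> h; rewrite mulrDr h; ring.
by apply: (mulIf (lt0r_neq0 den)); rewrite E mulVf// gt_eqF.
Qed.

End resolvent.

(** * Identification of the scale function *)

Section scale_function.
Context {R : realType}.
Local Notation mu := (@lebesgue_measure R).
Local Notation pos := (`]0, +oo[%classic : set R).
Variables (a b c : R) (W : R -> R).
Hypotheses (a0 : 0 < a) (a1 : a < 1) (b0 : 0 <= b) (c0 : 0 < c).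
Hypothesis WS : is_scale_function a b c W.

Local Notation w := (resolvent a b c).
Local Notation q := (sing_exp a).

Let q0 : 0 < q. Proof. exact: sing_exp_gt0. Qed.
Let q1 : q <= 1. Proof. exact: sing_exp_le1. Qed.
Let sw : singular a w. Proof. exact: singular_resolvent. Qed.

Lemma singular_resolvent' : singular q w.
Proof. by apply: singularW sw; rewrite ge_min lexx. Qed.

Lemma singular1 (r : R) : singular q (cst r).
Proof. exact: singularW (singular_cst r). Qed.

Lemma continuous_scale : {in pos, continuous W}.
Proof. by have [_ /continuous_within_itvcyP[/in_continuous_mksetP cf _] _ _] := WS. Qed.

Lemma laplace_scale r : 0 < r -> laplace_integrable r W /\
  laplace r W = (Phi a b c r)^-1.
Proof.
move=> r0; have [_ cW _ /(_ r r0) L] := WS.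
have mW : measurable_fun pos W.
  by apply: open_continuous_measurable_fun => //; exact: continuous_scale.
have mf' : measurable_fun pos (fun x => expR (- r * x) * W x).
  by apply: measurable_funM => //; exact: measurable_expRD.
have mf : measurable_fun pos (fun x => (expR (- r * x) * W x)%:E).
  exact/measurable_EFinP.
rewrite -integral_itv_obnd_cbnd// in L.
split; last by rewrite /laplace /Rintegral L.
apply/integrableP; split => //.
by have := integral_fin_num_abs mu (measurable_itv _) mf'; rewrite L => ->.
Qed.

Lemma continuous_convol1_resolvent : {in pos, continuous (convol (cst 1) w)}.
Proof.
move=> x xp; have x0 : 0 < x by move: xp; rewrite inE/= in_itv/= andbT.
apply: differentiable_continuous; apply/derivable1_diffP.
by have [] := convol1_derivable a0 sw x0 (continuous_resolvent a0 a1 b0 c0 xp).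
Qed.

(** For large r both sides have the transform 1 / (r (b + c r^a)), and both are continuous on (0,
    oo). *)
Lemma scaleE x : 0 < x -> W x = convol (cst 1) w x.
Proof.
move=> x0; apply/eqP; rewrite -subr_eq0; apply/eqP.
pose D y := W y - convol (cst 1) w y.
pose l := resolvent_rate a b c; have l0 : 0 < l by exact: resolvent_rate_gt0.
have H r : l < r -> laplace_integrable r D /\ laplace r D = 0.
  move=> lr; have r0 : 0 < r by exact: lt_trans lr.
  have [iW LW] := laplace_scale r0.
  have [iw Lw] := laplace_resolvent a0 a1 b0 c0 lr.
  have [i1 L1] := laplace_cst 1 r0.
  have [i1w L1w] := laplace_convol q0 q1 (singular1 1) singular_resolvent' i1 iw.
  have E y : expR (- r * y) * D y = expR (- r * y) * W y - expR (- r * y) * convol (cst 1) w y.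
    by rewrite mulrBr.
  split.
    rewrite /laplace_integrable (_ : (fun y => _) =
      fun y => (expR (- r * y) * W y - expR (- r * y) * convol (cst 1) w y)%:E).
      exact: integrableB_EFin.
    by apply/funext => y; rewrite E.
  have -> : laplace r D = laplace r W - laplace r (convol (cst 1) w).
    by rewrite /laplace -RintegralB//; apply: eq_Rintegral => y _; rewrite E.
  rewrite LW L1w L1 Lw /Phi powRD ?(gt_eqF r0) ?implybT// powRr1 ?(ltW r0)//.
  have ra := powR_gt0 a r0.
  have den : 0 < b + c * r `^ a by rewrite ltr_wpDl// mulr_gt0.
  rewrite (_ : b * r + c * (r `^ a * r) = r * (b + c * r `^ a)); last ring.
  by rewrite invfM mul1r subrr.
(* The transform of [w] is available strictly beyond [l], whereas [laplace_inj] includes its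
   starting point. *)
have lt1 : l < l + 1 by rewrite ltrDl.
apply: (@laplace_inj _ (l + 1) D) x0.
- move=> y yp; apply: continuousB; first exact: continuous_scale.
  exact: continuous_convol1_resolvent.
- by have [] := H _ lt1.
- by move=> r lr; have [] := H r (lt_le_trans lt1 lr).
Qed.

(** Near x, [W] is the primitive of [w]; the continuity of [w] makes the identity hold at every
    point and not just almost everywhere. *)
Lemma derive1_scale x : 0 < x -> derive1 W x = w x.
Proof.
move=> x0; have xp : x \in pos by rewrite inE/= in_itv/= x0.
have [_ <-] := convol1_derivable a0 sw x0 (continuous_resolvent a0 a1 b0 c0 xp).
rewrite !derive1E; apply: near_eq_derive; rewrite ?oner_eq0//.
by near=> y; apply: scaleE; near: y; exact: lt_nbhsr.
Unshelve. all: by end_near. Qed.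

(** Convolving w = k - b (k * w) with [L_K] and replacing L_K * k by 1 in both terms. *)
Lemma convol_L_K_resolvent x : 0 < x ->
  convol (L_K a c) w x = 1 - b * convol (cst 1) w x.
Proof.
move=> x0; have sL : singular q (L_K a c) by exact: singular_L_K.
have sk : singular q (frac_kernel a c) by exact: singular_frac_kernel'.
have sw' := singular_resolvent'.
have skw := singular_convol q0 q1 sk sw'.
transitivity (convol (L_K a c)
  (fun s => frac_kernel a c s + - b * convol (frac_kernel a c) w s) x).
  by apply: eq_convol => // s s0 _; rewrite (resolventE a0 a1 b0 c0 s0) mulNr.
rewrite (convolDr q0 q1 _ sL sk (singularZ (- b) skw)).
rewrite (convolZr q0 q1 _ _ sL skw) (convol_sonine a0 a1 c0 x0) mulNr.
congr (_ - _ * _); rewrite (convolA q0 q1 _ sL sk sw').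
by apply: eq_convol => // s s0 _; rewrite convol_sonine.
Qed.

End scale_function.

(** * The operator V *)

Section nonlinearity.
Context {R : realType}.
Local Notation mu := (@lebesgue_measure R).
Local Notation pos := (`]0, +oo[%classic : set R).

Lemma expR_remainder_ge0 (t : R) : 0 <= expR (- t) - 1 + t.
Proof. by have := expR_ge1Dx (- t); lra. Qed.

(** The bound has to be quadratic at 0 to offset the singularity y^(- a - 2) of the density; the
    exponential factor accounts for negative t, as [v] carries no sign. *)
Lemma expR_remainder_le (t : R) : expR (- t) - 1 + t <= t ^+ 2 * expR `|t|.
Proof.
set u := - t; have -> : t = - u by rewrite opprK.
rewrite normrN sqrrN; have hu := expR_ge1Dx u.
have h1 : expR u - 1 <= u * expR u.
  have := expR_ge1Dx (- u); rewrite -(ler_pM2r (expR_gt0 u)) -expRD addNr expR0; lra.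
have [u0|u0] := leP 0 u.
  rewrite ger0_norm//; have : u * (expR u - 1) <= u * (u * expR u) by rewrite ler_wpM2l.
  rewrite mulrA -expr2; lra.
have h2 : 1 <= expR `|u| by rewrite -expR0 ler_expR.
have h3 : u * (expR u - 1) <= u ^+ 2.
  by rewrite expr2 ler_wnM2l ?(ltW u0)//; lra.
apply: (@le_trans _ _ (u ^+ 2)); first lra.
by rewrite ler_peMr ?sqr_ge0.
Qed.

Lemma solution_class_singular (a : R) v : solution_class a v -> singular a v.
Proof.
move=> [cv bv]; split.
  by apply: open_continuous_measurable_fun => // x /[!inE]/= xp; exact: cv.
move=> T T0; have [M HM] := bv T T0; exists `|M| => // x x0 xT.
have : x `^ (1 - a) * `|v x| <= M by apply: HM; exists x => //=; rewrite in_itv/= x0.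
move=> /le_trans/(_ (ler_norm M)).
rewrite -(ler_pM2l (powR_gt0 (a - 1) x0)) mulrA -powRD ?(gt_eqF x0) ?implybT//.
by rewrite addrA subrK subrr powRr0 mul1r mulrC.
Qed.

Variables (a c : R) (v : R -> R).
Hypotheses (a0 : 0 < a) (a1 : a < 1) (c0 : 0 < c).
Hypothesis sv : singular a v.

Let P := convol (cst 1) v.
Let N := c * a * (a + 1) / Gamma (1 - a).

Let N0 : 0 <= N.
Proof.
have G : 0 < Gamma (1 - a) by apply: Gamma_gt0; rewrite ?subr_gt0 ?gerBl// ltW.
by rewrite divr_ge0 ?(ltW G)// !mulr_ge0 ?addr_ge0// ltW.
Qed.

Let rem (t : R) := expR (- t) - 1 + t.

(** Expressed through the primitive [P], the integrand of the operator becomes a jointly measurable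
    function of x and y, and its size is controlled by increments of [P]. *)
Let inner x y : 0 < x -> 0 < y ->
  \int[mu]_(r in `]Num.max (x - y) 0, x[) v r = P x - P (Num.max (x - y) 0).
Proof.
move=> x0 y0; have m0 : 0 <= Num.max (x - y) 0 by rewrite le_max lexx orbT.
have mx : Num.max (x - y) 0 <= x by rewrite ge_max (ltW x0) andbT gerBl ltW.
rewrite (convol1B a0 sv m0 mx) -Rintegral_itv_bndo_bndc; last first.
  apply: integrableS (integrable_restrict_pos a0 sv x) => // s /=.
  by rewrite !in_itv/= => /andP[ms sx]; rewrite (le_lt_trans m0)//= ltW.
apply: eq_Rintegral => s; rewrite inE/= in_itv/= => /andP[ms _].
by rewrite restrict_posE// (le_lt_trans m0).
Qed.

Let G (z : R * R) : R :=
  (if 0 < z.2 then rem (P z.1 - P (Num.max (z.1 - z.2) 0)) * nu_density a c z.2 else 0).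

Let mG : measurable_fun setT G.
Proof.
have mP : measurable_fun setT P by apply: measurable_convol; [exact: measurable_cst|case: sv].
apply: measurable_fun_ifT => //.
  by apply: measurable_fun_ltr.
apply: measurable_funM; last first.
  apply: measurable_funM => //.
  by apply: (measurableT_comp (f := fun y : R => y `^ (- a - 2))); [exact: measurable_powR|].
have mD : measurable_fun setT (fun z : R * R => P z.1 - P (Num.max (z.1 - z.2) 0)).
  apply: measurable_funB; first exact: measurableT_comp mP _.
  apply: (measurableT_comp mP); apply: measurable_maxr => //; exact: measurable_funB.
have mr : measurable_fun setT rem.
  apply: measurable_funD => //; apply: measurable_funB => //; exact: measurable_expRN.
exact: measurableT_comp mr mD.
Qed.

Let V_opE x : 0 < x -> V_op a c v x = \int[mu]_y G (x, y).
Proof.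
move=> x0; rewrite /V_op Rintegral_mkcond; apply: eq_Rintegral => y _.
rewrite patchE /G/=; case: ifPn.
  by rewrite inE/= in_itv/= andbT => y0; rewrite y0 inner.
by rewrite notin_setE/= in_itv/= andbT => /negP/negbTE ->.
Qed.

Lemma measurable_V_op : measurable_fun pos (V_op a c v).
Proof.
apply: (@eq_measurable_fun _ _ _ _ pos (fun x => \int[mu]_y G (x, y))).
  by move=> x; rewrite inE/= in_itv/= andbT => x0; rewrite V_opE.
by apply: measurable_funTS; exact: measurable_Rintegral_param mG.
Qed.

Let P_bound T C x u : 0 <= C ->
  (forall y, 0 < y -> y <= T -> `|v y| <= C * y `^ (a - 1)) ->
  0 < x -> x <= T -> 0 <= u -> u <= x -> `|P x - P u| <= C * (x `^ a / a).
Proof.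
move=> C0 vC x0 xT u0 ux; rewrite (convol1B a0 sv u0 ux).
have i1 := integrable_restrict_pos a0 sv x.
have i2 : mu.-integrable `]u, x] (EFin \o (v \_ pos)).
  apply: integrableS i1 => // s /=; rewrite !in_itv/= => /andP[us ->].
  by rewrite (le_lt_trans u0).
have i3 : mu.-integrable `]0, x[ (fun s => (C * s `^ (a - 1))%:E).
  by apply: integrableZl_EFin => //; exact: integrable_powR_itv.
rewrite (le_trans (le_normr_Rintegral _ _))// -lee_fin /Rintegral fineK; last first.
  by apply: integrable_fin_num => //; exact: (integrable_norm i2).
apply: (@le_trans _ _ (\int[mu]_(s in `]u, x[) `|(v \_ pos) s|%:E)%E).
  rewrite le_eqVlt integral_itv_bndo_bndc ?eqxx//.
  apply: measurable_funS (measurable_int mu (integrable_norm i2)) => //.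
  by apply: subset_itvl; rewrite bnd_simp.
apply: (@le_trans _ _ (\int[mu]_(s in `]0%R, x[) (C * s `^ (a - 1))%:E)%E); last first.
  under eq_integral do rewrite EFinM.
  rewrite integralZl//; last exact: integrable_powR_itv.
  by rewrite EFinM lee_wpmul2l ?lee_fin// integral_powR_itvoo_le.
apply: (@le_trans _ _ (\int[mu]_(s in `]u, x[) (C * s `^ (a - 1))%:E)%E).
  apply: ge0_le_integral => //.
  - apply: measurable_funS (measurable_int mu (integrable_norm i2)) => //.
    by apply: subset_itvl; rewrite bnd_simp.
  - by apply/measurable_EFinP; apply: measurable_funM => //; exact: measurable_powRD.
  - move=> s /=; rewrite in_itv/= => /andP[us sx].
    have s0 : 0 < s by exact: le_lt_trans us.
    by rewrite lee_fin restrict_posE// vC// (le_trans (ltW sx)).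
apply: ge0_subset_integral => //.
- exact: (measurable_int mu i3).
- by move=> s _; rewrite lee_fin mulr_ge0 ?powR_ge0.
- by apply: subset_itvr; rewrite bnd_simp.
Qed.

Let P_lip T C x u : 0 <= C ->
  (forall y, 0 < y -> y <= T -> `|v y| <= C * y `^ (a - 1)) ->
  0 < x -> x <= T -> 0 < u -> u <= x -> `|P x - P u| <= C * u `^ (a - 1) * (x - u).
Proof.
move=> C0 vC x0 xT u0 ux; rewrite (convol1B a0 sv (ltW u0) ux).
have i2 : mu.-integrable `]u, x] (EFin \o (v \_ pos)).
  apply: integrableS (integrable_restrict_pos a0 sv x) => // s /=.
  by rewrite !in_itv/= => /andP[us ->]; rewrite (lt_trans u0).
have mux : mu `]u, x]%classic = (x - u)%:E.
  rewrite lebesgue_measure_itv/= lte_fin; case: ltP => // xu.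
  by rewrite (le_anti (introT andP (conj xu ux))) subrr.
rewrite (le_trans (le_normr_Rintegral _ _))//.
apply: (@le_trans _ _ (\int[mu]_(s in `]u, x]) (C * u `^ (a - 1)))); last first.
  rewrite Rintegral_cst; last exact: measurable_itv.
  by rewrite [X in fine X]mux.
apply: le_Rintegral => //; first exact: (integrable_norm i2).
  apply: measurable_bounded_integrable => //; first by rewrite [X in (X < _)%E]mux ltry.
  by exists `|C * u `^ (a - 1)|; split=> // M hM s _; exact: ltW.
move=> s /=; rewrite in_itv/= => /andP[us sx].
have s0 : 0 < s by exact: lt_trans us.
rewrite restrict_posE// (le_trans (vC s s0 (le_trans sx xT)))// ler_wpM2l//.
by apply: le_powR_neg; rewrite ?ltW.
Qed.

(* Split the integral at [y = x / 2]: below, the increment of the primitive of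
   [v] is at most [C (x / 2)^(a - 1) y]; above, it is at most [C x^a / a]. *)
Lemma singular_V_op : singular a (V_op a c v).
Proof.
split; first exact: measurable_V_op.
move=> T T0; have [C C0 vC] := sv.2 T T0.
pose E := expR (C * (T `^ a / a)).
(* [E] bounds the exponential factor of [expR_remainder_le]. With h = x / 2, the part y < h gives
   C^2 h^(2 (a - 1)) h^(1 - a) / (1 - a), and the rest gives (C x^a / a)^2 h^(- a - 1) / (a + 1).
   Both are multiples of h^(a - 1), so the order of [v] at 0 is preserved. *)
pose K := E * N * C ^+ 2 * ((1 - a)^-1 + 2 `^ (2 * a) / (a ^+ 2 * (a + 1))).
exists (K * 2^-1 `^ (a - 1)).
  have h1 : 0 < 1 - a by rewrite subr_gt0.
  have h2 : 0 < a + 1 by rewrite addr_gt0.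
  have K2 : 0 <= (1 - a)^-1 + 2 `^ (2 * a) / (a ^+ 2 * (a + 1)).
    apply: addr_ge0; first by rewrite invr_ge0 ltW.
    by apply: divr_ge0; [exact: powR_ge0|apply: mulr_ge0 (sqr_ge0 _) _; exact: ltW].
  apply: mulr_ge0 (powR_ge0 _ _); apply: mulr_ge0 K2; apply: mulr_ge0 (sqr_ge0 _).
  exact: mulr_ge0 (expR_ge0 _) N0.
move=> x x0 xT; pose h := x / 2; have h0 : 0 < h by rewrite divr_gt0.
have xh : x = 2 * h by rewrite /h; field.
have a10 : 0 < 1 - a by rewrite subr_gt0.
have ap1 : 0 < a + 1 by rewrite addr_gt0.
have E0 : 0 <= E := expR_ge0 _.
pose A1 := C * h `^ (a - 1); pose A2 := C * (x `^ a / a).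
have A20 : 0 <= A2 by rewrite mulr_ge0 ?divr_ge0 ?powR_ge0// ltW.
have Ab y : 0 < y -> `|P x - P (Num.max (x - y) 0)| <= A2.
  move=> y0; apply: (P_bound C0 vC) => //; first by rewrite le_max lexx orbT.
  by rewrite ge_max (ltW x0) andbT gerBl ltW.
have Al y : 0 < y -> y < h -> `|P x - P (Num.max (x - y) 0)| <= A1 * y.
  move=> y0 yh; have xy : h <= x - y by lra.
  rewrite (max_idPl _); last by rewrite (le_trans (ltW h0)).
  have := P_lip C0 vC x0 xT (lt_le_trans h0 xy) _.
  rewrite gerBl (ltW y0) => /(_ isT)/le_trans; apply.
  rewrite subKr ler_wpM2r ?(ltW y0)// ler_wpM2l//.
  by apply: le_powR_neg => //; exact: ltW.
have remb y B : 0 < y -> 0 <= B -> `|P x - P (Num.max (x - y) 0)| <= B ->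
    rem (P x - P (Num.max (x - y) 0)) <= B ^+ 2 * E.
  move=> y0 B0 PB; apply: le_trans (expR_remainder_le _) _.
  apply: ler_pM; rewrite ?sqr_ge0 ?expR_ge0//.
    by rewrite -[leLHS](real_normK (num_real _)) ler_sqr ?nnegrE.
  rewrite ler_expR (le_trans (Ab y y0))// ler_wpM2l// ler_pM2r ?invr_gt0//.
  by apply: ge0_ler_powR; rewrite ?nnegrE ?(ltW a0) ?(ltW x0) ?(ltW T0).
pose g y := (G (x, y))%:E.
have mg D : measurable_fun D g.
  apply: measurable_funTS; apply/measurable_EFinP.
  apply: (measurableT_comp mG); exact: measurable_fun_pair.
have g0 y : (0 <= g y)%E.
  rewrite lee_fin /G/=; case: ifP => // _; rewrite mulr_ge0 ?expR_remainder_ge0//.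
  by rewrite mulr_ge0 ?powR_ge0.
have gE : (\int[mu]_y g y = \int[mu]_(y in pos) g y)%E.
  rewrite [RHS]integral_mkcond; apply: eq_integral => y _; rewrite patchE.
  case: ifPn => //; rewrite notin_setE/= in_itv/= andbT => /negP/negbTE h'.
  by rewrite /g /G/= h'.
have bnd : (\int[mu]_(y in pos) g y <= (K * 2^-1 `^ (a - 1) * x `^ (a - 1))%:E)%E.
  have pU : pos = `]0, h[ `|` `[h, +oo[.
    by apply/seteqP; split => y /=; rewrite !in_itv/= !andbT;
      [case: (ltP y h) => [_ ->|]; [left|right]|case => [/andP[]//|]; exact: lt_le_trans].
  have gU : (\int[mu]_(y in `]0%R, h[ `|` `[h, +oo[) g y =
      \int[mu]_(y in `]0%R, h[) g y + \int[mu]_(y in `[h, +oo[) g y)%E.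
    apply: ge0_integral_setU => //; first exact: mg.
    apply/disj_setPS => y [/=]; rewrite !in_itv/= andbT => /andP[_ yh] hy.
    by move: (lt_le_trans yh hy); rewrite ltxx.
  rewrite pU gU.
  have I1 : (\int[mu]_(y in `]0%R, h[) g y <=
      (E * N * A1 ^+ 2 * (h `^ (1 - a) / (1 - a)))%:E)%E.
    apply: (@le_trans _ _ (\int[mu]_(y in `]0%R, h[)
        ((E * N * A1 ^+ 2)%:E * (y `^ ((1 - a) - 1))%:E))%E).
      apply: ge0_le_integral => //.
      - exact: mg.
      - by apply: measurable_funeM; exact: measurable_powR_itv.
      - move=> y /=; rewrite in_itv/= => /andP[y0 yh]; rewrite -EFinM lee_fin /G/= y0.
        rewrite /nu_density -/N.
        have y2 : y `^ (1 - a - 1) = y ^+ 2 * y `^ (- a - 2).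
          rewrite -(powR_mulrn 2 (ltW y0)) -powRD ?(gt_eqF y0) ?implybT//.
          by congr (_ `^ _); ring.
        rewrite y2 [leRHS](_ : _ = ((A1 * y) ^+ 2 * E) * (N * y `^ (- a - 2))); last ring.
        apply: ler_wpM2r; first exact: mulr_ge0 N0 (powR_ge0 _ _).
        apply: remb => //; last exact: Al.
        by rewrite !mulr_ge0 ?powR_ge0// ltW.
    rewrite ge0_integralZl//; last 3 first.
    - exact: measurable_powR_itv.
    - by move=> y _; rewrite lee_fin powR_ge0.
    - by rewrite lee_fin; apply: mulr_ge0 (sqr_ge0 _); exact: mulr_ge0.
    rewrite [leRHS]EFinM lee_wpmul2l ?integral_powR_itvoo_le// lee_fin.
    by apply: mulr_ge0 (sqr_ge0 _); exact: mulr_ge0.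
  have I2 : (\int[mu]_(y in `[h, +oo[) g y <=
      (E * N * A2 ^+ 2 * (h `^ (- (a + 1)) / (a + 1)))%:E)%E.
    apply: (@le_trans _ _ (\int[mu]_(y in `[h, +oo[)
        ((E * N * A2 ^+ 2)%:E * (y `^ (- (a + 1) - 1))%:E))%E).
      apply: ge0_le_integral => //.
      - exact: mg.
      - by apply: measurable_funeM; exact: measurable_powR_itv.
      - move=> y /=; rewrite in_itv/= andbT => hy; have y0 : 0 < y by exact: lt_le_trans hy.
        rewrite -EFinM lee_fin /G/= y0 /nu_density -/N.
        have -> : - (a + 1) - 1 = - a - 2 by ring.
        rewrite [leRHS](_ : _ = (A2 ^+ 2 * E) * (N * y `^ (- a - 2))); last ring.
        apply: ler_wpM2r; first exact: mulr_ge0 N0 (powR_ge0 _ _).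
        by apply: remb => //; exact: Ab.
    rewrite ge0_integralZl//; last 3 first.
    - exact: measurable_powR_itv.
    - by move=> y _; rewrite lee_fin powR_ge0.
    - by rewrite lee_fin; apply: mulr_ge0 (sqr_ge0 _); exact: mulr_ge0.
    rewrite [leRHS]EFinM lee_wpmul2l ?integral_powR_itvcy_le// lee_fin.
    by apply: mulr_ge0 (sqr_ge0 _); exact: mulr_ge0.
  apply: le_trans (leeD I1 I2) _; rewrite -EFinD lee_fin.
  rewrite le_eqVlt; apply/orP; left; apply/eqP.
  have hn := gt_eqF h0.
  have e1 : h `^ (1 - a) = (h `^ (a - 1))^-1 by rewrite -powRN; congr (_ `^ _); ring.
  have e2 : h `^ (- (a + 1)) = (h `^ (a - 1))^-1 * h ^- 2.
    by rewrite -(powR_invn 2 (ltW h0)) -powRN -powRD ?hn ?implybT//; congr (_ `^ _); ring.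
  have e3 : x `^ a = 2 `^ a * (h * h `^ (a - 1)).
    by rewrite xh powRM ?(ltW h0)// mulr_powRB1 ?(ltW h0).
  have e4 : 2 `^ (2 * a) = (2 `^ a) ^+ 2 :> R.
    by rewrite -powR_mulrn ?powR_ge0// -powRrM mulrC.
  have e5 : 2^-1 `^ (a - 1) * x `^ (a - 1) = h `^ (a - 1).
    by rewrite -powRM ?invr_ge0 ?(ltW x0)//; congr (_ `^ _); rewrite /h mulrC.
  rewrite [RHS](_ : _ = K * h `^ (a - 1)); last by rewrite -e5 mulrA.
  rewrite /K /A1 /A2 e1 e2 e3 e4.
  have z0 := powR_gt0 (a - 1) h0; move: z0; set z := h `^ (a - 1) => z0.
  by field; rewrite !gt_eqF.
rewrite V_opE// /Rintegral -/g gE.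
have I0 : (0 <= \int[mu]_(y in pos) g y)%E by apply: integral_ge0.
rewrite ger0_norm ?fine_ge0// -lee_fin fineK// ge0_fin_numE//.
exact: le_lt_trans bnd (ltry _).
Qed.

End nonlinearity.

(** * The equivalence *)

Section equivalence.
Context {R : realType}.
Local Notation mu := (@lebesgue_measure R).
Local Notation pos := (`]0, +oo[%classic : set R).

Lemma eq_abs_continuous (p r : R) (f g : R -> R) : {in `[p, r]%classic, f =1 g} ->
  abs_continuous p r f -> abs_continuous p r g.
Proof.
move=> fg ac e e0; have [d d0 H] := ac e e0; exists d => // n u w uw tI sd.
apply: le_lt_trans (H n u w uw tI sd); apply: ler_sum => i _.
have [uwi sub] := uw i; move: uwi; rewrite le_eqVlt => /predU1P[->|uwi].
  by rewrite !subrr.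
have [pu wr] := subitv_endpoints uwi sub.
rewrite !fg ?inE/= ?in_itv/= ?pu ?wr ?andbT//.
  by rewrite (le_trans (ltW uwi)).
by rewrite (le_trans pu (ltW uwi)).
Qed.

Lemma abs_continuousB (p r : R) (f g : R -> R) :
  abs_continuous p r f -> abs_continuous p r g ->
  abs_continuous p r (fun x => f x - g x).
Proof.
move=> acf acg e e0; have e20 : 0 < e / 2 by rewrite divr_gt0.
have [d1 d10 H1] := acf _ e20; have [d2 d20 H2] := acg _ e20.
exists (Num.min d1 d2); first by rewrite lt_min d10.
move=> n u w uw tI; rewrite lt_min => /andP[sd1 sd2].
have h1 := H1 n u w uw tI sd1; have h2 := H2 n u w uw tI sd2.
apply: (@le_lt_trans _ _ (\sum_(i < n) (`|f (w i) - f (u i)| + `|g (w i) - g (u i)|))).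
  apply: ler_sum => i _.
  rewrite (_ : _ - _ = (f (w i) - f (u i)) - (g (w i) - g (u i))); last ring.
  exact: ler_normB.
by rewrite big_split/=; lra.
Qed.

Lemma Linfty_bound (g : R -> R) : Linfty_nonneg g ->
  measurable_fun pos g /\
  exists2 M : R, 0 <= M & \forall x \ae mu, 0 < x -> `|g x| <= M.
Proof.
move=> [gL _]; have /andP[mg fg] := gL.
have mg' : measurable_fun setT (g \_ `[0, +oo[) by move: mg; rewrite inE.
split.
  have : measurable_fun pos (g \_ `[0, +oo[) by exact: measurable_funTS.
  apply: eq_measurable_fun => x; rewrite inE/= in_itv/= andbT => x0.
  by rewrite patchE mem_set//= in_itv/= (ltW x0).
move: fg; rewrite inE /finLfun/= /finite_norm unlock/=.
(* The norm of exponent infinity is defined by cases on whether the whole space has positive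
   measure. *)
have muT : (0 < mu [set: R])%E.
  apply: (@lt_le_trans _ _ (mu `]0%R, 1%R[%classic)).
    by rewrite lebesgue_measure_itv/= lte_fin ltr01 sube0 lte_fin.
  by apply: le_measure; rewrite ?inE.
rewrite muT; set S := ess_sup _ _ => Soo.
exists (`|fine S|) => //.
have := ess_sup_ge mu (abse \o (EFin \o (g \_ `[0, +oo[))).
apply: filterS => x /= + x0.
rewrite patchE mem_set//=; last by rewrite in_itv/= (ltW x0).
move=> h; rewrite -lee_fin (le_trans h)// -/S.
by move: Soo; case: (S) => [r| |]//= _; rewrite ?lee_fin ?ler_norm ?leNye.
Qed.

Section solution.
Variables (a b c lambda : R) (g v : R -> R).
Hypotheses (a0 : 0 < a) (a1 : a < 1) (b0 : 0 <= b) (c0 : 0 < c).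
Hypothesis sol : solution_class a v.

Local Notation w := (resolvent a b c).
Local Notation q := (sing_exp a).
Local Notation K := (L_K a c).

Let q0 : 0 < q. Proof. exact: sing_exp_gt0. Qed.
Let q1 : q <= 1. Proof. exact: sing_exp_le1. Qed.
Let sw : singular q w. Proof. exact: singular_resolvent'. Qed.
Let sK : singular q K. Proof. exact: singular_L_K. Qed.
Let sv : singular q v.
Proof.
by apply: (@singularW _ _ a); [rewrite ge_min lexx|exact: solution_class_singular].
Qed.
Let s1 (r : R) : singular q (cst r). Proof. exact: singular1. Qed.

(** Stands for g - V v, modified on a null set so that its bound near 0 holds at every point; [gF]
    below makes the link. *)
Variable F : R -> R.
Hypothesis sF : singular q F.

Let H := fun s => F s - b * v s.

Let sH : singular q H.
Proof. by apply: singularB => //; exact: singularZ. Qed.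

Let swF := singular_convol q0 q1 sw sF.
Let s1w := singular_convol q0 q1 (s1 1) sw.

Let convol_1_minus f x : singular q f ->
  convol (fun s => 1 - b * convol (cst 1) w s) f x =
  convol (cst 1) f x - b * convol (cst 1) (convol w f) x.
Proof.
move=> sf; transitivity (convol (fun s => cst 1 s + - b * convol (cst 1) w s) f x).
  by apply: eq_convol => // s _ _; rewrite mulNr.
rewrite (convolDl q0 q1 _ (s1 1) (singularZ (- b) s1w) sf).
by rewrite (convolZl q0 q1 _ _ s1w sf) mulNr (convolA q0 q1 _ (s1 1) sw sf).
Qed.

Let convol_H f x : singular q f ->
  convol f H x = convol f F x - b * convol f v x.
Proof.
move=> sf; transitivity (convol f (fun s => F s + - b * v s) x).
  by apply: eq_convol => // s _ _; rewrite mulNr.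
rewrite (convolDr q0 q1 _ sf sF (singularZ (- b) sv)).
by rewrite (convolZr q0 q1 _ _ sf sv) mulNr.
Qed.

(** As L_K * w = 1 - b (1 * w), the terms carrying b assemble into - b times the Volterra equation
    convolved with 1, that is - b (1 * v). *)
Lemma volterra_convol_L_K : (forall x, 0 < x -> v x = lambda * w x + convol w F x) ->
  forall x, 0 < x -> convol K v x = lambda + convol (cst 1) H x.
Proof.
move=> vE x x0.
have L f : singular q f -> convol f v x = lambda * convol f w x + convol f (convol w F) x.
  move=> sf; rewrite -(convolZr q0 q1 _ _ sf sw).
  rewrite -(convolDr q0 q1 _ sf (singularZ lambda sw) swF).
  by apply: eq_convol => // s s0 _; exact: vE.
rewrite (convol_H _ (s1 1)) (L _ sK) (L _ (s1 1)).
rewrite (convol_L_K_resolvent a0 a1 b0 c0 x0) (convolA q0 q1 _ sK sw sF).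
have -> : convol (convol K w) F x = convol (fun s => 1 - b * convol (cst 1) w s) F x.
  by apply: eq_convol => // s s0 _; rewrite convol_L_K_resolvent.
by rewrite convol_1_minus//; ring.
Qed.

(** The convolution of [w] with L_K * v is computed in two ways, by associativity and by the
    hypothesis. The term b (1 * (w * v)) occurs in both and cancels, leaving an equality of
    primitives. It can be differentiated at every point: [v] is continuous by its class, and w * F
    because [w] is. *)
Lemma convol_L_K_volterra : (forall x, 0 < x -> convol K v x = lambda + convol (cst 1) H x) ->
  forall x, 0 < x -> v x = lambda * w x + convol w F x.
Proof.
move=> KE.
have E x : 0 < x -> convol (cst 1) v x =
    convol (cst 1) (fun s => lambda * w s + convol w F s) x.
  move=> x0; have s1H := singular_convol q0 q1 (s1 1) sH.
  have lhs : convol w (convol K v) x =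
      convol (cst 1) v x - b * convol (cst 1) (convol w v) x.
    rewrite (convolA q0 q1 _ sw sK sv) -convol_1_minus//.
    apply: eq_convol => // s s0 _.
    by rewrite (convolC _ sw.1 sK.1) convol_L_K_resolvent.
  have rhs : convol w (convol K v) x = lambda * convol (cst 1) w x +
      (convol (cst 1) (convol w F) x - b * convol (cst 1) (convol w v) x).
    transitivity (convol w (fun s => lambda * cst 1 s + convol (cst 1) H s) x).
      by apply: eq_convol => // s s0 _; rewrite KE// mulr1.
    rewrite (convolDr q0 q1 _ sw (singularZ lambda (s1 1)) s1H).
    rewrite (convolZr q0 q1 _ _ sw (s1 1)) (convolC _ sw.1 (s1 1).1).
    rewrite (convolA q0 q1 _ sw (s1 1) sH); congr (_ + _).
    transitivity (convol (convol (cst 1) w) H x).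
      by apply: eq_convol => // s _ _; rewrite (convolC _ sw.1 (s1 1).1).
    by rewrite convol_H// !(convolA q0 q1 _ (s1 1) sw).
  rewrite (convolDr q0 q1 _ (s1 1) (singularZ lambda sw) swF).
  rewrite (convolZr q0 q1 _ _ (s1 1) sw); move: lhs; rewrite rhs => h.
  by apply: (addIr (- (b * convol (cst 1) (convol w v) x))); rewrite -h; ring.
move=> x x0; have xp : x \in pos by rewrite inE/= in_itv/= x0.
have cv : {for x, continuous v}.
  by have [cv _] := sol; apply: cv; rewrite in_itv/= x0.
have cw : {in pos, continuous w} := continuous_resolvent a0 a1 b0 c0.
have cr : {for x, continuous (fun s => lambda * w s + convol w F s)}.
  apply: cvgD; first by apply: cvgMr; exact: cw.
  exact: (continuous_convol q0 q1 sw sF cw).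
have [_ <-] := convol1_derivable q0 sv x0 cv.
have [_ <-] := convol1_derivable q0 (singularD (singularZ lambda sw) swF) x0 cr.
rewrite !derive1E; apply: near_eq_derive.
by near=> y; apply: E; near: y; exact: lt_nbhsr.
Unshelve. all: by end_near. Qed.

Hypothesis gF : \forall x \ae mu, 0 < x -> g x - V_op a c v x = F x.

Lemma convol_L_K_fractional :
  (forall x, 0 < x -> convol K v x = lambda + convol (cst 1) H x) ->
  fractional_solution a b c lambda g v.
Proof.
move=> KE.
have Kcst y : 0 < y -> convol K v y = convol (cst 1) H y - (- lambda).
  by move=> y0; rewrite KE// opprK addrC.
split => //.
- move=> p r p0 pr.
  apply: (@eq_abs_continuous _ _ (fun x => convol (cst 1) H x - (- lambda))).
    move=> y; rewrite inE/= in_itv/= => /andP[py _].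
    by rewrite Kcst// (lt_le_trans p0).
  apply: abs_continuousB; first exact: (convol1_abs_continuous q0 sH).
  move=> e e0; exists 1 => // n u w' _ _ _.
  by under eq_bigr do rewrite subrr normr0; rewrite big1.
- have := convol1_ae_derivable q0 sH; move: gF.
  apply: filterS2; first exact: (ae_filter_ringOfSetsType mu).
  move=> x gFx h x0; have [d1 d2] := h x0.
  have near_E : \forall y \near x, convol K v y = convol (cst 1) H y - (- lambda).
    by near=> y; apply: Kcst; near: y; exact: lt_nbhsr.
  split.
    apply: (@near_eq_derivable _ _ _ (fun y => convol (cst 1) H y - (- lambda))).
      by near=> y; apply/esym; near: y.
    exact: derivableB.
  rewrite /RL_deriv derive1E (near_eq_derive _ near_E) deriveB// derive_cst subr0.
  by rewrite -derive1E d2 /H -gFx//; ring.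
- have h : lambda + convol (cst 1) H x @[x --> 0^'+] --> lambda.
    rewrite -[X in _ --> X]addr0; apply: cvgD; first exact: cvg_cst.
    exact: (convol1_cvg0 q0 sH).
  apply: cvg_trans h; apply: near_eq_cvg; near=> x.
  by apply/esym/KE; near: x; exact: nbhs_right_gt.
Unshelve. all: by end_near. Qed.

(** The difference [D] of L_K * v and 1 * H is absolutely continuous on compact intervals of (0, oo)
    with derivative zero almost everywhere, hence constant. As 1 * H tends to 0 at 0, the initial
    condition gives the constant. *)
Lemma fractional_convol_L_K : fractional_solution a b c lambda g v ->
  forall x, 0 < x -> convol K v x = lambda + convol (cst 1) H x.
Proof.
move=> [_ ac dK lim0] x x0.
pose D y := convol K v y - convol (cst 1) H y.
have cD p : 0 < p -> p < x -> D x = D p.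
  move=> p0 px; apply: (@abs_continuous_derive0 _ D p x px).
    by apply: abs_continuousB; [exact: ac|exact: (convol1_abs_continuous q0 sH)].
  have := convol1_ae_derivable q0 sH; move: gF; move: dK.
  apply: filterS3; first exact: (ae_filter_ringOfSetsType mu).
  move=> y dKy gFy dHy py yx; have y0 : 0 < y by exact: lt_trans py.
  have [k1 k2] := dKy y0; have [h1 h2] := dHy y0.
  split; first exact: derivableB.
  rewrite derive1E deriveB// -!derive1E h2 -/(RL_deriv a c v y) k2 /H -gFy//; ring.
have limD : D y @[y --> 0^'+] --> lambda.
  by rewrite -[X in _ --> X]subr0; apply: cvgB => //; exact: (convol1_cvg0 q0 sH).
have limc : D y @[y --> 0^'+] --> D x.
  apply: (@cvg_trans _ (cst (D x) @ 0^'+)); last exact: cvg_cst.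
  apply: near_eq_cvg; near=> y; rewrite /=; apply: cD; near: y.
    exact: nbhs_right_gt.
  exact: nbhs_right_lt.
have : D x = lambda by exact: (cvg_unique _ limc limD).
by rewrite /D => /eqP; rewrite subr_eq => /eqP.
Unshelve. all: by end_near. Qed.

End solution.

End equivalence.

Lemma ae_eq_convol {R : realType} (f h h' : R -> R) (x : R) :
  measurable_fun (`]0, +oo[ : set R) f -> measurable_fun (`]0, +oo[ : set R) h ->
  measurable_fun (`]0, +oo[ : set R) h' ->
  (\forall s \ae (@lebesgue_measure R), 0 < s -> h s = h' s) ->
  convol f h x = convol f h' x.
Proof.
move=> mf mh mh' hh'; rewrite /convol /Rintegral; congr fine.
apply: ae_eq_integral => //.
- by apply/measurable_EFinP; exact: measurable_convol_itv.
- by apply/measurable_EFinP; exact: measurable_convol_itv.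
- apply: filterS hh'; first exact: (ae_filter_ringOfSetsType lebesgue_measure).
  by move=> s hs /=; rewrite in_itv/= => /andP[s0 _]; rewrite hs.
Qed.

Theorem corollary2p15 (R : realType) (alpha b c lambda : R) (W g : R -> R)
    (alpha_gt0 : 0 < alpha) (alpha_lt1 : alpha < 1)
    (b_ge0 : 0 <= b) (c_gt0 : 0 < c) (lambda_ge0 : 0 <= lambda)
    (W_scale : is_scale_function alpha b c W)
    (g_Linfty : Linfty_nonneg g) :
  forall v : R -> R,
    volterra_solution alpha c lambda g W v <->
    fractional_solution alpha b c lambda g v.
Proof.
move=> v; have [mg [M M0 gM]] := Linfty_bound g_Linfty.
suff main : solution_class alpha v ->
    (volterra_solution alpha c lambda g W v <->
     fractional_solution alpha b c lambda g v).
  by split=> [[] | []] sol *; apply/main.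
move=> sol; have sv := solution_class_singular sol.
have sV := singular_V_op alpha_gt0 alpha_lt1 c_gt0 sv.
(* [g] is only almost everywhere bounded. *)
pose g' x := if `|g x| <= M then g x else 0.
have sg' : singular 1 g'.
  split.
    apply: measurable_fun_if => //.
      by apply: measurable_fun_ler => //; exact: measurableT_comp.
      exact: measurable_funS mg.
  move=> T T0; exists M => // x x0 xT.
  by rewrite subrr powRr0 mulr1 /g'; case: ifP; rewrite ?normr0.
pose F x := g' x - V_op alpha c v x.
have sF : singular (sing_exp alpha) F.
  apply: singularB; first by apply: singularW sg'; exact: sing_exp_le1.
  by apply: singularW sV; rewrite ge_min lexx.
have gF : \forall x \ae lebesgue_measure, 0 < x -> g x - V_op alpha c v x = F x.
  apply: filterS gM; first exact: (ae_filter_ringOfSetsType lebesgue_measure).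
  by move=> x gx x0; rewrite /F /g' gx.
have mgV : measurable_fun (`]0, +oo[ : set R) (fun s => g s - V_op alpha c v s).
  by apply: measurable_funB => //; case: sV.
have sw := singular_resolvent' alpha_gt0 alpha_lt1 b_ge0 c_gt0.
(* The convolution depends on [g] only up to null sets, so [g] may be replaced by its bounded
   version [g']. *)
have VE x : 0 < x ->
    lambda * derive1 W x + convol (fun s => g s - V_op alpha c v s) (derive1 W) x =
    lambda * resolvent alpha b c x + convol (resolvent alpha b c) F x.
  move=> x0; rewrite (derive1_scale alpha_gt0 alpha_lt1 b_ge0 c_gt0 W_scale x0).
  rewrite -(ae_eq_convol x sw.1 mgV sF.1 gF) (convolC x sw.1 mgV); congr (_ + _).
  apply: eq_convol => // s s0 _.
  exact: (derive1_scale alpha_gt0 alpha_lt1 b_ge0 c_gt0 W_scale s0).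
split=> [[_ vE] | fs].
  apply: (convol_L_K_fractional alpha_gt0 alpha_lt1 sol sF gF).
  apply: (volterra_convol_L_K alpha_gt0 alpha_lt1 b_ge0 c_gt0 sol sF) => x x0.
  by rewrite vE// VE.
split=> // x x0; rewrite VE//; move: x x0.
apply: (convol_L_K_volterra alpha_gt0 alpha_lt1 b_ge0 c_gt0 sol sF).
exact: (fractional_convol_L_K alpha_gt0 alpha_lt1 sol sF gF).
Qed.
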